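(* Let $\mu_n$ ($n\ge 0$) be the Taylor coefficients of the entire function $s(s-1)\zeta(s)$ at $s=1$, i.e. $s(s-1)\zeta(s)=\sum_{n=0}^{\infty}\mu_n(s-1)^n$. Then for every integer $n\ge 0$, $$\mu_n=\frac{2}{n!}\int_{0}^{\infty}\mu(t)\,\mathrm{Re}\big\{(a-\log t)^{n}\big\}\,dt.$$
   Context: $\zeta$ denotes the Riemann zeta function. Define for $t>0$ $$\mu(t)=\frac{d^2}{dt^2}\frac{te^{-t}}{1-e^{-t}}=-\frac{(2+t)e^{t}}{(e^{t}-1)^2}+\frac{2te^{2t}}{(e^{t}-1)^3},$$ and let $a=\log(2\pi)+i\frac{\pi}{2}$; $\log t$ is the real logarithm. *)

(* Defs.v *)
From Stdlib Require Import Reals.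
Open Scope R_scope.

Definition cplx := (R * R)%type.
Definition cmul (z w : cplx) : cplx :=
  (fst z * fst w - snd z * snd w, fst z * snd w + snd z * fst w).
Fixpoint cpow (z : cplx) (n : nat) : cplx :=
  match n with O => (1, 0) | S k => cmul z (cpow z k) end.
Definition Re (z : cplx) : R := fst z.

Definition a_minus_log (t : R) : cplx := (ln (2 * PI) - ln t, PI / 2).

(* mu(t) = d^2/dt^2 ( t e^{-t} / (1 - e^{-t}) ), explicit form from the paper *)
Definition mu_fun (t : R) : R :=
  - ((2 + t) * exp t) / (exp t - 1) ^ 2 + 2 * t * exp (2 * t) / (exp t - 1) ^ 3.

Definition is_zeta (s z : R) : Prop :=
  infinite_sum (fun k => Rpower (INR (S k)) (- s)) z.

Definition improper_integral_0_inf (f : R -> R) (l : R) : Prop :=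
  (forall a b, 0 < a -> a <= b -> inhabited (Riemann_integrable f a b)) /\
  (forall eps, 0 < eps -> exists d, 0 < d /\ exists M, 0 < M /\
     forall a b (pr : Riemann_integrable f a b),
       0 < a -> a < d -> M < b -> Rabs (RiemannInt pr - l) < eps).

(* Main.v *)
From Stdlib Require Import Reals Factorial Lra Lia.
From Coquelicot Require Import Coquelicot.
Require Import Defs.
Open Scope R_scope.

(* Put [u = s - 1], [Q t = t/(e^t-1) + t/2 - 1] ([bose] below, with [Q'' = mu_fun]) and
   [c_k = 2 PI k]. The partial fraction expansion [Q t = sum_k 2t^2/(t^2+c_k^2)] integrates
   term by term against [t^(-u-2)] to [2 (2 PI)^(-1-u) zeta(1+u) J(u)], where
   [J(u) = int_0^oo x^(-u)/(1+x^2) dx = PI/(2 cos(PI u/2))]. Two integrations by parts turn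
   this into
     [u (1+u) zeta(1+u) = 2 (2 PI)^u cos(PI u/2) int_0^oo mu_fun(t) t^(-u) dt]
   for small [u > 0], and the factor of [mu_fun] on the right is the real part of
   [exp(u (a - log t))]. Expanding it in powers of [u] and comparing coefficients gives the
   formula. All the integrals are computed in the variable [y = log t], where the integrands
   are continuous on the whole line and are dominated by [exp (- d |y|)]. *)

(** * Integrals over the real line *)

(** The correction [t / 2 - 1] leaves the second derivative of t/(e^t-1) unchanged but makes Q of
    order t^2 at 0 and of order t at infinity, so that t^(-u-2) Q(t) is integrable for 0 < u < 1.
    The identity is thus reached only to the right of s = 1, on the real line; a right interval
    still determines every Taylor coefficient. In the variable y the k-th partial fraction is a
    translate by log c_k of one fixed kernel, so all terms share one integral and only the factor
    c_k^(-1-u) depends on k. Both classical expansions involved, that of coth behind Q and that of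
    the cosecant behind J, are values at 0 of cosine series, of a cosh and of a cos. Interchanges of
    sum and integral all go through [line_integral_series], where a common weight exp(-d|y|) does
    the work of dominated convergence. The limit 1/2 for u comes from the last expansion: bounding
    |a - log t|^n by half of the decay of mu_fun(t) t costs 2^n n!, the n! cancels the Taylor
    denominator, and the geometric series of ratio 2u remains. *)

Lemma exp_le_compat (x y : R) : x <= y -> exp x <= exp y.
Proof. intros [H | ->]; [left; now apply exp_increasing | apply Rle_refl]. Qed.

Lemma cont_ex_RInt (f : R -> R) (a b : R) :
  (forall x, continuous f x) -> ex_RInt f a b.
Proof. intros Hf; apply (ex_RInt_continuous (V := R_CompleteNormedModule)); auto. Qed.

Lemma RInt_lin (f g : R -> R) (c d a b : R) :
  ex_RInt f a b -> ex_RInt g a b ->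
  RInt (fun x => c * f x + d * g x) a b = c * RInt f a b + d * RInt g a b.
Proof.
  intros Hf Hg.
  apply is_RInt_unique.
  apply (is_RInt_plus (V := R_NormedModule) (fun x => c * f x) (fun x => d * g x));
    apply (is_RInt_scal (V := R_NormedModule)); now apply (RInt_correct (V := R_CompleteNormedModule)).
Qed.

Lemma cont_lin (f g : R -> R) (c d x : R) :
  continuous f x -> continuous g x -> continuous (fun y => c * f y + d * g y) x.
Proof.
  intros Hf Hg.
  apply (continuous_plus (V := R_NormedModule) (fun y => c * f y) (fun y => d * g y));
    now apply (continuous_scal_r (V := R_NormedModule)).
Qed.

(* Meaningful for continuous [f] only: [RInt] is a junk value when [f] is not integrable. *)
Definition line_integral (f : R -> R) (l : R) : Prop :=
  forall eps, 0 < eps -> exists M, forall a b, a < - M -> M < b ->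
    Rabs (RInt f a b - l) < eps.

Lemma Rabs_lt_eps_eq (x y : R) : (forall eps, 0 < eps -> Rabs (x - y) < eps) -> x = y.
Proof.
  intros H; destruct (Req_dec x y) as [E | E]; [exact E |].
  assert (P : 0 < Rabs (x - y)) by (apply Rabs_pos_lt; lra).
  generalize (H _ P); lra.
Qed.

Lemma line_integral_unique (f : R -> R) (l m : R) :
  line_integral f l -> line_integral f m -> l = m.
Proof.
  intros Hl Hm; apply Rabs_lt_eps_eq; intros e He.
  destruct (Hl (e / 2)) as [M HM]; [lra |].
  destruct (Hm (e / 2)) as [N HN]; [lra |].
  set (b := Rmax M N + 1).
  assert (M < b) by (unfold b; generalize (Rmax_l M N); lra).
  assert (N < b) by (unfold b; generalize (Rmax_r M N); lra).
  assert (A := HM (- b) b ltac:(lra) ltac:(lra)).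
  assert (B := HN (- b) b ltac:(lra) ltac:(lra)).
  revert A B; unfold Rabs; repeat destruct Rcase_abs; lra.
Qed.

Lemma line_integral_ext (f g : R -> R) (l : R) :
  (forall x, f x = g x) -> line_integral f l -> line_integral g l.
Proof.
  intros E H e He; destruct (H e He) as [M HM]; exists M; intros a b Ha Hb.
  rewrite <- (RInt_ext f g); auto.
Qed.

Lemma line_integral_lin (f g : R -> R) (c d l m : R) :
  (forall x, continuous f x) -> (forall x, continuous g x) ->
  line_integral f l -> line_integral g m ->
  line_integral (fun x => c * f x + d * g x) (c * l + d * m).
Proof.
  intros Cf Cg Hl Hm e He.
  assert (Pc := Rabs_pos c); assert (Pd := Rabs_pos d).
  set (K := Rabs c + Rabs d + 1).
  assert (HK : 0 < e / K) by (apply Rdiv_lt_0_compat; unfold K; lra).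
  destruct (Hl (e / K) HK) as [M HM]; destruct (Hm (e / K) HK) as [N HN].
  exists (Rmax M N); intros a b Ha Hb.
  assert (X := Rmax_l M N); assert (Y := Rmax_r M N).
  rewrite RInt_lin by now apply cont_ex_RInt.
  assert (A := HM a b ltac:(lra) ltac:(lra)); assert (B := HN a b ltac:(lra) ltac:(lra)).
  replace (c * RInt f a b + d * RInt g a b - (c * l + d * m))
    with (c * (RInt f a b - l) + d * (RInt g a b - m)) by ring.
  eapply Rle_lt_trans; [apply Rabs_triang |]; rewrite !Rabs_mult.
  assert (E : e = Rabs c * (e / K) + Rabs d * (e / K) + e / K) by (unfold K in *; field; lra).
  assert (Rabs c * Rabs (RInt f a b - l) <= Rabs c * (e / K)) by (apply Rmult_le_compat_l; lra).
  assert (Rabs d * Rabs (RInt g a b - m) <= Rabs d * (e / K)) by (apply Rmult_le_compat_l; lra).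
  lra.
Qed.

Lemma line_integral_scal (f : R -> R) (c l : R) :
  (forall x, continuous f x) -> line_integral f l ->
  line_integral (fun x => c * f x) (c * l).
Proof.
  intros Cf Hl.
  apply line_integral_ext with (fun x => c * f x + 0 * f x); [intros; ring |].
  replace (c * l) with (c * l + 0 * l) by ring.
  now apply line_integral_lin.
Qed.

Lemma line_integral_shift (f : R -> R) (h l : R) :
  (forall x, continuous f x) -> line_integral f l ->
  line_integral (fun x => f (x - h)) l.
Proof.
  intros Cf Hl e He; destruct (Hl e He) as [M HM].
  exists (M + Rabs h); intros a b Ha Hb.
  assert (RInt (fun x => f (x - h)) a b = RInt f (a - h) (b - h)) as ->.
  { replace (a - h) with (1 * a + - h) by ring; replace (b - h) with (1 * b + - h) by ring.
    rewrite <- (RInt_comp_lin (V := R_CompleteNormedModule) f 1 (- h) a b) by now apply cont_ex_RInt.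
    apply RInt_ext; intros; unfold scal; simpl; unfold mult; simpl.
    rewrite Rmult_1_l; f_equal; ring. }
  assert (X := Rle_abs h); assert (Y := Rle_abs (- h)); rewrite Rabs_Ropp in Y.
  apply HM; lra.
Qed.

(** The sign of [k] is left open: negative [k] serves the right tail, positive [k] the left one. *)
Lemma RInt_exp_bound (f : R -> R) (C k a b : R) :
  (forall x, continuous f x) -> k <> 0 -> a <= b ->
  (forall x, a <= x <= b -> Rabs (f x) <= C * exp (k * x)) ->
  Rabs (RInt f a b) <= C / k * (exp (k * b) - exp (k * a)).
Proof.
  intros Cf Hk Hab Hf.
  apply (norm_RInt_le (V := R_NormedModule) f (fun x => C * exp (k * x)) a b); auto.
  - now apply (RInt_correct (V := R_CompleteNormedModule)), cont_ex_RInt.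
  - replace (C / k * (exp (k * b) - exp (k * a))) with
      (minus (C / k * exp (k * b)) (C / k * exp (k * a)))
      by (unfold minus, plus, opp; simpl; ring).
    apply (is_RInt_derive (V := R_CompleteNormedModule) (fun x => C / k * exp (k * x))).
    + intros; auto_derive; [exact I | field; auto].
    + intros; apply (ex_derive_continuous (V := R_NormedModule)); auto_derive; exact I.
Qed.

Definition exp_dominated (f : R -> R) (C d : R) : Prop :=
  forall x, Rabs (f x) <= C * exp (- d * Rabs x).

Lemma exp_dominated_pos (f : R -> R) (C d : R) : exp_dominated f C d -> 0 <= C.
Proof.
  intros H; generalize (H 0); rewrite Rabs_R0, Rmult_0_r, exp_0.
  generalize (Rabs_pos (f 0)); lra.
Qed.

Lemma dominated_tail_right (f : R -> R) (C d a b : R) :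
  (forall x, continuous f x) -> exp_dominated f C d -> 0 < d -> 0 <= a <= b ->
  Rabs (RInt f a b) <= C / d * exp (- d * a).
Proof.
  intros Cf Hf Hd Hab; assert (HC := exp_dominated_pos _ _ _ Hf).
  eapply Rle_trans; [apply (RInt_exp_bound f C (- d)); auto; try lra |].
  - intros x Hx; generalize (Hf x); now rewrite (Rabs_pos_eq x) by lra.
  - replace (C / - d * (exp (- d * b) - exp (- d * a))) with
      (C / d * exp (- d * a) - C / d * exp (- d * b)) by (field; lra).
    assert (0 <= C / d * exp (- d * b)); [| lra].
    apply Rmult_le_pos; [apply Rdiv_le_0_compat; lra | left; apply exp_pos].
Qed.

Lemma dominated_tail_left (f : R -> R) (C d a b : R) :
  (forall x, continuous f x) -> exp_dominated f C d -> 0 < d -> a <= b <= 0 ->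
  Rabs (RInt f a b) <= C / d * exp (d * b).
Proof.
  intros Cf Hf Hd Hab; assert (HC := exp_dominated_pos _ _ _ Hf).
  eapply Rle_trans; [apply (RInt_exp_bound f C d); auto; try lra |].
  - intros x Hx; generalize (Hf x); rewrite (Rabs_left1 x) by lra.
    now replace (- d * - x) with (d * x) by ring.
  - assert (0 <= C / d * exp (d * a)); [| lra].
    apply Rmult_le_pos; [apply Rdiv_le_0_compat; lra | left; apply exp_pos].
Qed.

Lemma RInt_split3 (f : R -> R) (a b c d : R) :
  (forall x, continuous f x) ->
  RInt f a d = RInt f a b + RInt f b c + RInt f c d.
Proof.
  intros Cf.
  rewrite <- (RInt_Chasles (V := R_CompleteNormedModule) f a c d) by now apply cont_ex_RInt.
  rewrite <- (RInt_Chasles (V := R_CompleteNormedModule) f a b c) by now apply cont_ex_RInt.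
  reflexivity.
Qed.

Lemma dominated_bound (f : R -> R) (C d a b : R) :
  (forall x, continuous f x) -> exp_dominated f C d -> 0 < d -> a <= 0 <= b ->
  Rabs (RInt f a b) <= 2 * C / d.
Proof.
  intros Cf Hf Hd Hab.
  rewrite (RInt_split3 f a 0 0 b Cf), (RInt_point (V := R_CompleteNormedModule)).
  assert (A := dominated_tail_left f C d a 0 Cf Hf Hd ltac:(lra)).
  assert (B := dominated_tail_right f C d 0 b Cf Hf Hd ltac:(lra)).
  rewrite Rmult_0_r, exp_0 in A, B.
  unfold zero; simpl; rewrite Rplus_0_r.
  eapply Rle_trans; [apply Rabs_triang |]; lra.
Qed.

Lemma exp_decay_small (K d eps : R) : 0 <= K -> 0 < d -> 0 < eps ->
  exists M, 0 <= M /\ forall x, M <= x -> K * exp (- d * x) < eps.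
Proof.
  intros HK Hd He.
  exists (K / eps / d).
  split; [repeat apply Rdiv_le_0_compat; lra |].
  intros x Hx.
  assert (A : K / eps <= d * x).
  { replace (K / eps) with (d * (K / eps / d)) by (field; lra).
    apply Rmult_le_compat_l; lra. }
  assert (B := exp_ineq1_le (d * x)).
  replace (- d * x) with (- (d * x)) by ring; rewrite exp_Ropp.
  assert (K < eps * exp (d * x)).
  { replace K with (eps * (K / eps)) by (field; lra).
    apply Rmult_lt_compat_l; lra. }
  apply Rmult_lt_reg_r with (exp (d * x)); [apply exp_pos |].
  rewrite Rmult_assoc, Rinv_l; [lra | generalize (exp_pos (d * x)); lra].
Qed.

(** The integrals over [-n, n] form a Cauchy sequence, because enlarging an interval that contains
    [-M, M] adds two tails of size C/d exp(-dM) at most. *)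
Lemma dominated_line_integral (f : R -> R) (C d : R) :
  (forall x, continuous f x) -> exp_dominated f C d -> 0 < d ->
  exists l, line_integral f l.
Proof.
  intros Cf Hf Hd; assert (HC := exp_dominated_pos _ _ _ Hf).
  set (u := fun n => RInt f (- INR n) (INR n)).
  (* One comparison for two purposes: with symmetric intervals it gives the Cauchy property, with
     arbitrary [a], [b] it passes from the sequence to two independent end points. *)
  assert (T : forall M a b (n : nat), 0 <= M -> a <= - M -> M <= b -> - INR n <= a -> b <= INR n ->
             Rabs (RInt f a b - u n) <= 2 * C / d * exp (- d * M)).
  { intros M a b n H0 Ha Hb Hna Hnb; unfold u.
    rewrite (RInt_split3 f (- INR n) a b (INR n) Cf).
    assert (A := dominated_tail_left f C d (- INR n) a Cf Hf Hd ltac:(lra)).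
    assert (B := dominated_tail_right f C d b (INR n) Cf Hf Hd ltac:(lra)).
    assert (exp (d * a) <= exp (- d * M)) by (apply exp_le_compat; nra).
    assert (exp (- d * b) <= exp (- d * M)) by (apply exp_le_compat; nra).
    assert (0 <= C / d) by (apply Rdiv_le_0_compat; lra).
    assert (C / d * exp (d * a) <= C / d * exp (- d * M)) by (apply Rmult_le_compat_l; lra).
    assert (C / d * exp (- d * b) <= C / d * exp (- d * M)) by (apply Rmult_le_compat_l; lra).
    replace (2 * C / d * exp (- d * M)) with (C / d * exp (- d * M) + C / d * exp (- d * M)) by (field; lra).
    revert A B; unfold Rabs; repeat destruct Rcase_abs; lra. }
  assert (U : ex_finite_lim_seq u).
  { apply ex_lim_seq_cauchy_corr; intros eps.
    destruct (exp_decay_small (2 * C / d) d (eps / 2)) as [M [M0 HM]]; auto.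
    { apply Rdiv_le_0_compat; lra. } { apply is_pos_div_2. }
    destruct (INR_unbounded M) as [N X].
    exists N; intros n m Hn Hm.
    assert (Y := le_INR _ _ Hn); assert (Z := le_INR _ _ Hm).
    set (p := max n m).
    assert (P := le_INR _ _ (Nat.le_max_l n m)); assert (Q := le_INR _ _ (Nat.le_max_r n m)).
    fold p in P, Q.
    assert (A := T M (- INR n) (INR n) p M0 ltac:(lra) ltac:(lra) ltac:(lra) ltac:(lra)).
    assert (B := T M (- INR m) (INR m) p M0 ltac:(lra) ltac:(lra) ltac:(lra) ltac:(lra)).
    fold (u n) in A; fold (u m) in B.
    generalize (HM M ltac:(lra)).
    revert A B; unfold Rabs; repeat destruct Rcase_abs; lra. }
  destruct U as [l Hl]; exists l; intros e He.
  destruct (exp_decay_small (2 * C / d) d (e / 2)) as [M [M0 HM]]; auto; try lra.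
  { apply Rdiv_le_0_compat; lra. }
  exists M; intros a b Ha Hb.
  apply is_lim_seq_spec in Hl.
  assert (He2 : 0 < e / 2) by lra.
  destruct (Hl (mkposreal _ He2)) as [N HN]; simpl in HN.
  destruct (INR_unbounded (Rmax (- a) b)) as [K HK].
  set (p := max N K).
  assert (X : INR K <= INR p) by apply le_INR, Nat.le_max_r.
  assert (Y := Rmax_l (- a) b); assert (Z := Rmax_r (- a) b).
  assert (A := T M a b p M0 ltac:(lra) ltac:(lra) ltac:(lra) ltac:(lra)).
  assert (B := HN p (Nat.le_max_l _ _)).
  generalize (HM M ltac:(lra)).
  revert A B; unfold Rabs; repeat destruct Rcase_abs; lra.
Qed.

Lemma line_integral_bound (f : R -> R) (C d l : R) :
  (forall x, continuous f x) -> exp_dominated f C d -> 0 < d -> line_integral f l ->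
  Rabs l <= 2 * C / d.
Proof.
  intros Cf Hf Hd Hl; apply le_epsilon; intros e He.
  destruct (Hl e He) as [M HM].
  assert (X := Rmax_l M 0); assert (Y := Rmax_r M 0).
  assert (A := HM (- (Rmax M 0 + 1)) (Rmax M 0 + 1) ltac:(lra) ltac:(lra)).
  assert (B := dominated_bound f C d (- (Rmax M 0 + 1)) (Rmax M 0 + 1) Cf Hf Hd ltac:(lra)).
  revert A B; unfold Rabs; repeat destruct Rcase_abs; lra.
Qed.

Lemma line_integral_sum (f : nat -> R -> R) (l : nat -> R) (n : nat) :
  (forall k x, continuous (f k) x) -> (forall k, line_integral (f k) (l k)) ->
  (forall x, continuous (fun y => sum_f_R0 (fun k => f k y) n) x) /\
  line_integral (fun y => sum_f_R0 (fun k => f k y) n) (sum_f_R0 l n).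
Proof.
  intros Cf Hl; induction n as [| n [C I]]; simpl; [now split; [apply Cf | apply Hl] |].
  split.
  - intros x; apply (continuous_plus (V := R_NormedModule) (fun y => sum_f_R0 (fun k => f k y) n));
      [apply C | apply Cf].
  - apply line_integral_ext with
      (fun y => 1 * sum_f_R0 (fun k => f k y) n + 1 * f (S n) y); [intros; ring |].
    replace (sum_f_R0 l n + l (S n)) with (1 * sum_f_R0 l n + 1 * l (S n)) by ring.
    now apply line_integral_lin.
Qed.

(** The Weierstrass test in quantitative form: the tail of [b] times the weight bounds the tail of
    [a]. The weight factors out, so at each point x it can be exp(-d|x|). *)
Lemma dominated_series_remainder (a b : nat -> R) (w A B : R) (n : nat) :
  (forall k, Rabs (a k) <= b k * w) -> 0 <= w -> is_series a A -> is_series b B ->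
  Rabs (A - sum_f_R0 a n) <= (B - sum_f_R0 b n) * w.
Proof.
  intros H Hw HA HB.
  apply is_series_Reals in HA; apply is_series_Reals in HB.
  (* The terms of [b] are known to be nonnegative only through [b k * w], which says nothing when
     the weight vanishes; in that case all [a k] are 0. *)
  destruct (Req_dec w 0) as [W0 | W0].
  - assert (Z : forall k, a k = 0).
    { intros k; specialize (H k); rewrite W0, Rmult_0_r in H.
      generalize (Rabs_pos (a k)); intros.
      destruct (Req_dec (a k) 0) as [E | E]; [exact E | apply Rabs_pos_lt in E; lra]. }
    assert (S0 : forall m, sum_f_R0 a m = 0).
    { induction m; simpl; rewrite ?IHm, ?Z; ring. }
    assert (A = 0) as ->.
    { apply (UL_sequence (sum_f_R0 a)); [exact HA |].
      intros e He; exists O; intros m _; rewrite S0; unfold Rdist; rewrite Rminus_0_r, Rabs_R0; lra. }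
    rewrite S0, W0, Rminus_0_r, Rabs_R0; lra.
  - assert (B' : forall k, 0 <= b k).
    { intros k; specialize (H k); generalize (Rabs_pos (a k)); intros; nra. }
    assert (X : forall m, Rabs (sum_f_R0 a (n + m) - sum_f_R0 a n) <= (sum_f_R0 b (n + m) - sum_f_R0 b n) * w).
    { induction m as [| m IH].
      - rewrite Nat.add_0_r, !Rminus_diag, Rabs_R0; lra.
      - rewrite Nat.add_succ_r; simpl; specialize (H (S (n + m))).
        replace (sum_f_R0 a (n + m) + a (S (n + m)) - sum_f_R0 a n) with
          (sum_f_R0 a (n + m) - sum_f_R0 a n + a (S (n + m))) by ring.
        eapply Rle_trans; [apply Rabs_triang |]; lra. }
    apply le_epsilon; intros e He.
    assert (Ew : 0 < e / (2 * (w + 1))) by (apply Rdiv_lt_0_compat; lra).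
    destruct (HA (e / 2)) as [N1 HN1]; [lra |].
    destruct (HB _ Ew) as [N2 HN2].
    set (m := max N1 N2).
    assert (P := HN1 (n + m)%nat ltac:(lia)); assert (Q := HN2 (n + m)%nat ltac:(lia)).
    unfold Rdist in P, Q; specialize (X m).
    assert (Q' : sum_f_R0 b (n + m) - B <= e / (2 * (w + 1))).
    { eapply Rle_trans; [apply Rle_abs |]; lra. }
    assert (Q2 : (sum_f_R0 b (n + m) - B) * w <= e / (2 * (w + 1)) * w).
    { apply Rmult_le_compat_r; lra. }
    assert (Q3 : e / (2 * (w + 1)) * (w + 1) = e / 2) by (field; lra).
    revert P X; unfold Rabs; repeat destruct Rcase_abs; lra.
Qed.

(** The remainder after n terms is again exponentially dominated, with the tail of [b] as constant,
    so its integral is at most 2/d times that tail and tends to 0. *)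
Lemma line_integral_series (f : nat -> R -> R) (F : R -> R) (b l : nat -> R) (B d : R) :
  (forall k x, continuous (f k) x) -> (forall x, continuous F x) ->
  0 < d -> (forall k, exp_dominated (f k) (b k) d) -> is_series b B ->
  (forall x, is_series (fun k => f k x) (F x)) ->
  (forall k, line_integral (f k) (l k)) ->
  exp_dominated F B d /\ exists L, line_integral F L /\ is_series l L.
Proof.
  intros Cf CF Hd Hb HB HF Hl.
  assert (R : forall n x, Rabs (F x - sum_f_R0 (fun k => f k x) n) <= (B - sum_f_R0 b n) * exp (- d * Rabs x)).
  { intros n x; apply dominated_series_remainder; auto; [| left; apply exp_pos].
    intros k; apply Hb. }
  assert (D : exp_dominated F B d).
  { intros x; specialize (R O x); specialize (Hb O x); simpl in R.
    replace (F x) with (F x - f 0%nat x + f 0%nat x) by ring.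
    eapply Rle_trans; [apply Rabs_triang |]; lra. }
  split; [exact D |].
  destruct (dominated_line_integral F B d CF D Hd) as [L HL].
  exists L; split; [exact HL |].
  apply is_series_Reals; intros e He.
  apply is_series_Reals in HB.
  destruct (HB (e * d / 2)) as [N HN].
  { apply Rdiv_lt_0_compat; [apply Rmult_lt_0_compat |]; lra. }
  exists N; intros n Hn; specialize (HN n Hn); unfold Rdist in *.
  destruct (line_integral_sum f l n Cf Hl) as [CS IS].
  assert (I : line_integral (fun x => 1 * F x + -1 * sum_f_R0 (fun k => f k x) n)
             (1 * L + -1 * sum_f_R0 l n)) by now apply line_integral_lin.
  assert (J : Rabs (1 * L + -1 * sum_f_R0 l n) <= 2 * (B - sum_f_R0 b n) / d).
  { refine (line_integral_bound _ _ d _ _ _ Hd I).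
    - intros x; now apply cont_lin.
    - intros x.
      replace (1 * F x + -1 * sum_f_R0 (fun k => f k x) n) with
        (F x - sum_f_R0 (fun k => f k x) n) by ring.
      apply R. }
  replace (1 * L + -1 * sum_f_R0 l n) with (- (sum_f_R0 l n - L)) in J by ring.
  rewrite Rabs_Ropp in J.
  eapply Rle_lt_trans; [exact J |].
  apply Rmult_lt_reg_r with (d / 2); [lra |].
  replace (2 * (B - sum_f_R0 b n) / d * (d / 2)) with (B - sum_f_R0 b n) by (field; lra).
  replace (e * (d / 2)) with (e * d / 2) by field.
  rewrite Rabs_minus_sym in HN.
  eapply Rle_lt_trans; [apply Rle_abs | exact HN].
Qed.

(** Integration by parts on the line: the integral of f - c g is a difference of values of [H],
    which vanish at both ends. *)
Lemma line_integral_of_derivative (H f g : R -> R) (c l m : R) :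
  (forall x, continuous f x) -> (forall x, continuous g x) ->
  (forall x, is_derive H x (f x - c * g x)) ->
  (forall eps, 0 < eps -> exists M, forall x, M <= Rabs x -> Rabs (H x) < eps) ->
  line_integral f l -> line_integral g m -> l = c * m.
Proof.
  intros Cf Cg DH VH Hl Hm.
  assert (A : line_integral (fun x => 1 * f x + - c * g x) 0).
  { intros e He; destruct (VH (e / 2)) as [M HM]; [lra |].
    exists (Rmax M 0); intros a b Ha Hb.
    assert (X := Rmax_l M 0); assert (Y := Rmax_r M 0).
    rewrite (is_RInt_unique (V := R_CompleteNormedModule) _ _ _ (minus (H b) (H a))).
    - assert (P := HM a ltac:(rewrite Rabs_left; lra)).
      assert (Q := HM b ltac:(rewrite Rabs_right; lra)).
      unfold minus, plus, opp; simpl.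
      revert P Q; unfold Rabs; repeat destruct Rcase_abs; lra.
    - apply (is_RInt_derive (V := R_CompleteNormedModule)); intros x _.
      + replace (1 * f x + - c * g x) with (f x - c * g x) by ring; apply DH.
      + now apply cont_lin. }
  assert (B := line_integral_lin f g 1 (- c) l m Cf Cg Hl Hm).
  generalize (line_integral_unique _ _ _ A B); lra.
Qed.

(** * Dirichlet's theorem at an end point *)

Lemma continuous_on_ex_RInt (f : R -> R) (a b : R) : a <= b ->
  (forall x, a <= x <= b -> continuous f x) -> ex_RInt f a b.
Proof.
  intros Hab Cf; apply (ex_RInt_continuous (V := R_CompleteNormedModule)).
  now rewrite Rmin_left, Rmax_right by lra.
Qed.

Lemma RInt_ext_R (f g : R -> R) (a b : R) :
  (forall x, Rmin a b < x < Rmax a b -> f x = g x) -> RInt f a b = RInt g a b :> R.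
Proof. apply (RInt_ext (V := R_CompleteNormedModule)). Qed.

(** * Decay of coefficients against an orthogonal family of constant norm *)

Section Bessel.
Variables (psi : R -> R) (e : nat -> R -> R) (a b q : R).
Hypotheses (Hab : a <= b) (Hq : 0 < q).
Hypothesis Cpsi : forall x, a <= x <= b -> continuous psi x.
Hypothesis Ce : forall j x, a <= x <= b -> continuous (e j) x.
Hypothesis Horth : forall i j, (i < j)%nat -> RInt (fun x => e i x * e j x) a b = 0 :> R.
Hypothesis Hnorm : forall i, RInt (fun x => e i x * e i x) a b = q :> R.

Let c j := RInt (fun x => psi x * e j x) a b.

Fixpoint residual (n : nat) : R -> R :=
  match n with
  | O => psi
  | S m => fun x => residual m x - c m / q * e m x
  end.

Lemma residual_continuous n x : a <= x <= b -> continuous (residual n) x.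
Proof.
  intros Hx; induction n as [| n IH]; simpl; [now apply Cpsi |].
  apply (continuous_minus (V := R_NormedModule) (residual n)); [exact IH |].
  apply (continuous_scal_r (V := R_NormedModule) (c n / q) (e n)); now apply Ce.
Qed.

Lemma ex_RInt_mult_on (f g : R -> R) :
  (forall x, a <= x <= b -> continuous f x) -> (forall x, a <= x <= b -> continuous g x) ->
  ex_RInt (fun x => f x * g x) a b.
Proof.
  intros Cf Cg; apply continuous_on_ex_RInt; [exact Hab |]; intros x Hx.
  apply (continuous_mult (K := R_AbsRing) f g); auto.
Qed.

(** By orthogonality the projections removed so far, on [e i] with i < n, are invisible to [e j] for
    j >= n; the coefficients of [psi] itself remain valid at every later step. *)
Lemma residual_coef n j : (n <= j)%nat -> RInt (fun x => residual n x * e j x) a b = c j :> R.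
Proof.
  induction n as [| n IH]; intros Hj; [reflexivity |].
  simpl.
  rewrite (RInt_ext_R _ (fun x => 1 * (residual n x * e j x) + - (c n / q) * (e n x * e j x)))
    by (intros; ring).
  rewrite RInt_lin, IH, Horth by (try lia; apply ex_RInt_mult_on; auto using residual_continuous).
  ring.
Qed.

(** Pythagoras for a single projection. Removing one projection at a time keeps double sums out of
    the integrals. *)
Lemma residual_norm n :
  RInt (fun x => residual (S n) x * residual (S n) x) a b =
  RInt (fun x => residual n x * residual n x) a b - c n * c n / q.
Proof.
  simpl.
  rewrite (RInt_ext_R _ (fun x => 1 * (residual n x * residual n x) + - (c n / q) *
      (2 * (residual n x * e n x) + - (c n / q) * (e n x * e n x)))) by (intros; ring).
  assert (X : ex_RInt (fun x => residual n x * residual n x) a b)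
    by (apply ex_RInt_mult_on; apply residual_continuous).
  assert (Y : ex_RInt (fun x => residual n x * e n x) a b)
    by (apply ex_RInt_mult_on; [apply residual_continuous | apply Ce]).
  assert (Z : ex_RInt (fun x => e n x * e n x) a b)
    by (apply ex_RInt_mult_on; apply Ce).
  rewrite RInt_lin; [| exact X |].
  - rewrite (RInt_lin _ _ 2 _ a b Y Z), residual_coef, Hnorm by lia; field; lra.
  - apply continuous_on_ex_RInt; [exact Hab |]; intros x Hx.
    apply (cont_lin (fun x => residual n x * e n x) (fun x => e n x * e n x));
      apply (continuous_mult (K := R_AbsRing)); auto using residual_continuous.
Qed.

(** The squared norms of the residuals decrease and are nonnegative, hence converge; their
    successive differences c_n^2/q therefore tend to 0. *)
Lemma bessel_lim : is_lim_seq c 0.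
Proof.
  set (v := fun n => RInt (fun x => residual n x * residual n x) a b).
  assert (S : forall n, v (S n) = v n - c n * c n / q) by exact residual_norm.
  assert (P : forall n, 0 <= v n).
  { intros n; apply RInt_ge_0; [exact Hab | apply ex_RInt_mult_on; apply residual_continuous |].
    intros; apply Rle_0_sqr. }
  destruct (ex_finite_lim_seq_decr v 0) as [l Hl]; auto.
  { intros n; rewrite S.
    assert (0 <= c n * c n / q) by (apply Rdiv_le_0_compat; [apply Rle_0_sqr | exact Hq]); lra. }
  assert (L : is_lim_seq (fun n => v n - v (Datatypes.S n)) (l - l)).
  { apply is_lim_seq_minus'; [exact Hl | now apply -> is_lim_seq_incr_1]. }
  rewrite Rminus_diag in L.
  apply is_lim_seq_spec; apply is_lim_seq_spec in L.
  intros eps; assert (He := cond_pos eps).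
  assert (E : 0 < eps * eps / q) by (apply Rdiv_lt_0_compat; nra).
  destruct (L (mkposreal _ E)) as [N HN]; exists N; intros n Hn.
  specialize (HN n Hn); simpl in HN; rewrite S, !Rminus_0_r in *.
  replace (v n - (v n - c n * c n / q)) with (c n * c n / q) in HN by ring.
  apply Rabs_def2 in HN; destruct HN as [HN _].
  unfold Rdiv in HN; apply Rmult_lt_reg_r in HN; [| now apply Rinv_0_lt_compat].
  rewrite <- (Rabs_pos_eq eps) by lra.
  apply Rsqr_lt_abs_0; exact HN.
Qed.
End Bessel.

(** A difference quotient with its removable singularity at 0 filled in. The quotient of two slopes
    is a version of (phi x - phi 0) / sin(PI x) that is continuous at 0 as well. *)
Definition slope (g : R -> R) (d x : R) : R :=
  if Req_EM_T x 0 then d else (g x - g 0) / x.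

Lemma slope_continuous (g : R -> R) (d x : R) :
  (forall x, continuous g x) -> is_derive g 0 d -> continuous (slope g d) x.
Proof.
  intros Cg Dg; destruct (Req_dec x 0) as [-> | Hx].
  - apply is_derive_Reals in Dg.
    apply continuity_pt_filterlim; intros e He.
    destruct (Dg e He) as [delta Hd]; exists delta; split; [apply cond_pos |].
    intros y [[_ Hy] Hy']; simpl in *; unfold Rdist in *; rewrite Rminus_0_r in Hy'.
    unfold slope; destruct (Req_EM_T y 0) as [E | E]; [congruence |].
    destruct (Req_EM_T 0 0) as [_ | E0]; [| congruence].
    specialize (Hd y E Hy'); now rewrite Rplus_0_l in Hd.
  - apply (continuous_ext_loc _ (fun y => (g y - g 0) * / y)).
    + exists (mkposreal _ (Rabs_pos_lt _ Hx)); intros y Hy; simpl in Hy.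
      unfold slope; destruct (Req_EM_T y 0) as [-> | E]; [| reflexivity].
      unfold ball, AbsRing_ball, abs, minus, plus, opp in Hy; simpl in Hy.
      unfold AbsRing_ball, abs, minus, plus, opp in Hy; simpl in Hy.
      rewrite Rplus_0_l, Rabs_Ropp in Hy; lra.
    + apply (continuous_mult (K := R_AbsRing) (fun y => g y - g 0) (fun y => / y)).
      * apply (continuous_minus (V := R_NormedModule) g); [apply Cg | apply continuous_const].
      * apply (ex_derive_continuous (V := R_NormedModule)); auto_derive; exact Hx.
Qed.

Lemma is_series_of_lim (a : nat -> R) (l : R) :
  is_lim_seq (sum_f_R0 a) l -> is_series a l.
Proof. intros H; apply is_series_Reals; now apply is_lim_seq_Reals in H. Qed.

(** In the cosine series of an even 1-periodic function the modes k and -k merge, so every mode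
    counts twice except the constant one. *)
Definition cos_weight (k : nat) : R := match k with O => 1 | S _ => 2 end.

(** Each product 2 cos A sin B is sin(A+B) - sin(A-B), and the sum telescopes. The form without
    division holds at x = 0 too. *)
Lemma dirichlet_kernel (n : nat) (x : R) :
  sum_f_R0 (fun k => cos_weight k * cos (2 * PI * INR k * x)) n * sin (PI * x) =
  sin ((2 * INR n + 1) * PI * x).
Proof.
  induction n as [| n IH].
  - simpl; replace (2 * PI * 0 * x) with 0 by ring; rewrite cos_0.
    replace ((2 * 0 + 1) * PI * x) with (PI * x) by ring; ring.
  - rewrite tech5, Rmult_plus_distr_r, IH, S_INR.
    change (cos_weight (S n)) with 2.
    replace ((2 * (INR n + 1) + 1) * PI * x) with (2 * PI * (INR n + 1) * x + PI * x) by ring.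
    replace ((2 * INR n + 1) * PI * x) with (2 * PI * (INR n + 1) * x - PI * x) by ring.
    rewrite sin_plus, sin_minus; ring.
Qed.

Lemma sin_INR_PI (n : nat) : sin (INR n * PI) = 0.
Proof. apply sin_eq_0_1; exists (Z.of_nat n); now rewrite <- INR_IZR_INZ. Qed.

Lemma RInt_cos_half (c : R) : c <> 0 ->
  RInt (fun x => cos (c * x)) 0 (1 / 2) = sin (c / 2) / c :> R.
Proof.
  intros Hc; apply is_RInt_unique.
  replace (sin (c / 2) / c) with (minus (sin (c * (1 / 2)) / c) (sin (c * 0) / c)).
  - apply (is_RInt_derive (V := R_CompleteNormedModule) (fun x => sin (c * x) / c)); intros.
    + auto_derive; [exact I | field; exact Hc].
    + apply (ex_derive_continuous (V := R_NormedModule)); auto_derive; exact I.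
  - unfold minus, plus, opp; simpl; rewrite Rmult_0_r, sin_0.
    replace (c * (1 / 2)) with (c / 2) by field; field; exact Hc.
Qed.

Lemma RInt_cos_zero (n : nat) : (0 < n)%nat ->
  RInt (fun x => cos (2 * PI * INR n * x)) 0 (1 / 2) = 0 :> R.
Proof.
  intros Hn; assert (P := PI_RGT_0); assert (N := lt_0_INR n Hn).
  rewrite RInt_cos_half by nra.
  replace (2 * PI * INR n / 2) with (INR n * PI) by field.
  rewrite sin_INR_PI; apply Rmult_0_l.
Qed.

Lemma cont_cos_lin (c x : R) : continuous (fun x => cos (c * x)) x.
Proof. apply (ex_derive_continuous (V := R_NormedModule)); auto_derive; exact I. Qed.

Lemma cont_sin_lin (c x : R) : continuous (fun x => sin (c * x)) x.
Proof. apply (ex_derive_continuous (V := R_NormedModule)); auto_derive; exact I. Qed.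

(** Product to sum: the cosine of index i+j+1 integrates to 0 over [0, 1/2]. The difference i-j is
    kept real, so that one formula yields both orthogonality and, for i = j, the squared norm
    1/4. *)
Lemma RInt_odd_sines (i j : nat) :
  RInt (fun x => sin ((2 * INR i + 1) * PI * x) * sin ((2 * INR j + 1) * PI * x)) 0 (1 / 2) =
  / 2 * RInt (fun x => cos (2 * PI * (INR i - INR j) * x)) 0 (1 / 2) :> R.
Proof.
  rewrite (RInt_ext_R _ (fun x => / 2 * cos (2 * PI * (INR i - INR j) * x) +
                               - / 2 * cos (2 * PI * INR (S (i + j)) * x))).
  - rewrite RInt_lin by (apply cont_ex_RInt; intros; apply cont_cos_lin).
    rewrite (RInt_cos_zero (S (i + j))) by lia; ring.
  - intros x _; rewrite S_INR, plus_INR.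
    set (A := (2 * INR i + 1) * PI * x); set (B := (2 * INR j + 1) * PI * x).
    replace (2 * PI * (INR i - INR j) * x) with (A - B) by (unfold A, B; ring).
    replace (2 * PI * (INR i + INR j + 1) * x) with (A + B) by (unfold A, B; ring).
    rewrite cos_plus, cos_minus; field.
Qed.

Lemma RInt_sum (f : nat -> R -> R) (a b : R) (n : nat) :
  (forall k x, continuous (f k) x) ->
  (forall x, continuous (fun y => sum_f_R0 (fun k => f k y) n) x) /\
  RInt (fun x => sum_f_R0 (fun k => f k x) n) a b = sum_f_R0 (fun k => RInt (f k) a b) n :> R.
Proof.
  intros Cf; induction n as [| n [C E]]; simpl; [split; [apply Cf | reflexivity] |].
  split.
  - intros x; apply (continuous_plus (V := R_NormedModule) (fun y => sum_f_R0 (fun k => f k y) n));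
      [apply C | apply Cf].
  - rewrite (RInt_ext_R _ (fun x => 1 * sum_f_R0 (fun k => f k x) n + 1 * f (S n) x)) by (intros; ring).
    rewrite RInt_lin, E by (apply cont_ex_RInt; auto); ring.
Qed.

(* Dirichlet's theorem at the end point 0. Dividing [phi - phi 0] by
   [sin (PI x)] leaves a continuous function, whose coefficients against the orthogonal
   family [sin ((2 j + 1) PI x)] tend to 0 by Bessel's inequality. *)
Lemma cosine_series_at_0 (phi : R -> R) (d : R) :
  (forall x, continuous phi x) -> is_derive phi 0 d ->
  is_series (fun k => cos_weight k *
      RInt (fun x => 2 * (phi x * cos (2 * PI * INR k * x))) 0 (1 / 2)) (phi 0).
Proof.
  intros Cphi Dphi; assert (HPI := PI_RGT_0).
  set (sig := fun x => sin (PI * x)).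
  assert (Dsig : is_derive sig 0 PI).
  { unfold sig; auto_derive; [exact I |]; rewrite Rmult_0_r, cos_0; ring. }
  assert (Csig : forall x, continuous sig x) by (intros; apply cont_sin_lin).
  set (psi := fun x => slope phi d x * / slope sig PI x).
  assert (Hsig : forall x, 0 < x <= 1 / 2 -> 0 < sig x).
  { intros x Hx; apply sin_gt_0; nra. }
  assert (Hs0 : sig 0 = 0) by (unfold sig; now rewrite Rmult_0_r, sin_0).
  assert (Cpsi : forall x, 0 <= x <= 1 / 2 -> continuous psi x).
  { intros x Hx; apply (continuous_mult (K := R_AbsRing) (slope phi d)).
    - now apply slope_continuous.
    - apply continuous_comp; [now apply slope_continuous |].
      apply (ex_derive_continuous (V := R_NormedModule)); auto_derive.
      unfold slope; destruct (Req_EM_T x 0) as [E | E]; [lra |].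
      rewrite Hs0, Rminus_0_r; assert (0 < sig x / x); [| lra].
      apply Rdiv_lt_0_compat; [apply Hsig; lra | lra]. }
  assert (L := bessel_lim psi (fun j x => sin ((2 * INR j + 1) * PI * x)) 0 (1 / 2) (/ 4)
    ltac:(lra) ltac:(lra) Cpsi (fun j x _ => cont_sin_lin _ x)).
  assert (L' : is_lim_seq (fun j => RInt (fun x => psi x * sin ((2 * INR j + 1) * PI * x)) 0 (1 / 2)) 0).
  { apply L.
    - intros i j Hij; rewrite RInt_odd_sines.
      rewrite (RInt_ext_R _ (fun x => cos (2 * PI * INR (j - i) * x))).
      + rewrite RInt_cos_zero by lia; ring.
      + intros x _; rewrite minus_INR by lia.
        rewrite <- cos_neg; f_equal; ring.
    - intros i; rewrite RInt_odd_sines.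
      rewrite (RInt_ext_R _ (fun _ => 1)).
      + rewrite RInt_const; unfold scal; simpl; unfold mult; simpl; field.
      + intros x _; rewrite Rminus_diag, Rmult_0_r, Rmult_0_l; apply cos_0. }
  clear L.
  apply is_series_of_lim.
  (* The partial sum is 2 times the integral of phi T with T the Dirichlet kernel. T has mass 1/2 on
     [0, 1/2], so the constant [phi 0] reproduces itself, and phi - phi 0 = psi sin(PI x) turns T
     into sin((2n+1) PI x). *)
  apply is_lim_seq_ext with (fun n => phi 0 + 2 * RInt (fun x => psi x * sin ((2 * INR n + 1) * PI * x)) 0 (1 / 2)).
  2:{ replace (Finite (phi 0)) with (Finite (phi 0 + 2 * 0)) by (f_equal; ring).
      apply is_lim_seq_plus'; [apply is_lim_seq_const |].
      now apply (is_lim_seq_scal_l _ 2 0). }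
  intros n; symmetry.
  set (T := fun x => sum_f_R0 (fun k => cos_weight k * cos (2 * PI * INR k * x)) n).
  assert (CT : forall x, continuous T x).
  { refine (proj1 (RInt_sum (fun k x => cos_weight k * cos (2 * PI * INR k * x)) 0 (1/2) n _)).
    intros; apply (continuous_scal_r (V := R_NormedModule)), cont_cos_lin. }
  assert (IT : RInt T 0 (1 / 2) = / 2 :> R).
  { unfold T; rewrite (proj2 (RInt_sum (fun k x => cos_weight k * cos (2 * PI * INR k * x)) 0 (1/2) n
       (fun k x => continuous_scal_r (V := R_NormedModule) _ _ x (cont_cos_lin _ x)))).
    assert (Z : forall k, RInt (fun x => cos_weight k * cos (2 * PI * INR k * x)) 0 (1 / 2) =
      match k with O => / 2 | S _ => 0 end :> R).
    { intros k; rewrite (RInt_scal (V := R_CompleteNormedModule) (fun x => cos (2 * PI * INR k * x)))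
        by (apply cont_ex_RInt; intros; apply cont_cos_lin).
      destruct k as [| k].
      - rewrite (RInt_ext_R _ (fun _ => 1)).
        + rewrite RInt_const; unfold scal; simpl; unfold mult; simpl; field.
        + intros x _; simpl; rewrite Rmult_0_r, Rmult_0_l; apply cos_0.
      - rewrite RInt_cos_zero by lia; apply Rmult_0_r. }
    transitivity (sum_f_R0 (fun k => match k with O => / 2 | S _ => 0 end) n);
      [apply sum_eq; intros k _; apply Z |].
    clear; induction n as [| n IH]; simpl; [reflexivity | rewrite IH; ring]. }
  transitivity (RInt (fun x => 2 * (phi x * T x)) 0 (1 / 2)).
  { rewrite (RInt_ext_R (fun x => 2 * (phi x * T x))
      (fun x => sum_f_R0 (fun k => cos_weight k * (2 * (phi x * cos (2 * PI * INR k * x)))) n)).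
    - destruct (RInt_sum (fun k x => cos_weight k * (2 * (phi x * cos (2 * PI * INR k * x)))) 0 (1/2) n)
        as [_ E].
      + intros k x.
        apply (continuous_scal_r (V := R_NormedModule)), (continuous_scal_r (V := R_NormedModule)).
        apply (continuous_mult (K := R_AbsRing) phi); [apply Cphi | apply cont_cos_lin].
      + rewrite E; apply sum_eq; intros k _; symmetry.
        apply (RInt_scal (V := R_CompleteNormedModule)).
        apply cont_ex_RInt; intros x.
        apply (continuous_scal_r (V := R_NormedModule)).
        apply (continuous_mult (K := R_AbsRing) phi); [apply Cphi | apply cont_cos_lin].
    - intros x _; unfold T; clear; induction n as [| n IH]; simpl; [ring |].
      rewrite !Rmult_plus_distr_l, IH; ring. }
  rewrite (RInt_ext_R _ (fun x => 2 * phi 0 * T x + 2 * (psi x * sin ((2 * INR n + 1) * PI * x)))).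
  - rewrite RInt_lin, IT; [field | now apply cont_ex_RInt |].
    apply continuous_on_ex_RInt; [lra |]; intros x Hx.
    apply (continuous_mult (K := R_AbsRing) psi); [now apply Cpsi | apply cont_sin_lin].
  - rewrite Rmin_left, Rmax_right by lra; intros x Hx.
    rewrite <- dirichlet_kernel; fold (T x).
    unfold psi, slope; destruct (Req_EM_T x 0) as [E | E]; [lra |].
    assert (S := Hsig x ltac:(lra)); unfold sig at 2; rewrite Rmult_0_r, sin_0.
    unfold sig in *; field; lra.
Qed.

(** * Partial fractions of coth and of the cosecant *)

Ltac as_real_eq := match goal with |- @eq _ ?x ?y => change (@eq R x y) end.

(** This is the cosine series of cosh(t(1/2 - x)) at x = 0, scaled by t/(2 sinh(t/2)). The value
    becomes (t/2) coth(t/2) = t/(e^t-1) + t/2, and the -1 is the term k = 0, removed by the shift of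
    index. *)
Lemma coth_series (t : R) : 0 < t ->
  is_series (fun k => 2 * t ^ 2 / (t ^ 2 + (2 * PI * INR (S k)) ^ 2)) (t / (exp t - 1) + t / 2 - 1).
Proof.
  intros Ht; assert (HPI := PI_RGT_0).
  set (phi := fun x => cosh (t * (1 / 2 - x))).
  assert (Cphi : forall x, continuous phi x).
  { intros x; apply (ex_derive_continuous (V := R_NormedModule)); unfold phi, cosh.
    auto_derive; exact I. }
  assert (Dphi : is_derive phi 0 (- t * sinh (t / 2))).
  { unfold phi, cosh, sinh; auto_derive; [exact I |].
    replace (t * (1 / 2 + - 0)) with (t / 2) by field; field. }
  assert (S := cosine_series_at_0 phi _ Cphi Dphi).
  set (e := exp (t / 2)).
  assert (He : 1 < e) by (unfold e; rewrite <- exp_0; apply exp_increasing; lra).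
  assert (Het : exp t = e * e) by (unfold e; rewrite <- exp_plus; f_equal; field).
  assert (Hsh : sinh (t / 2) = (e - / e) / 2).
  { unfold sinh; rewrite exp_Ropp; reflexivity. }
  assert (Hie : / e < 1) by (rewrite <- Rinv_1; apply Rinv_lt_contravar; lra).
  assert (Hp : 0 < sinh (t / 2)) by lra.
  assert (Hden : forall w, 0 < t ^ 2 + w ^ 2) by (intros; nra).
  apply (is_series_scal_l (t / (2 * sinh (t / 2)))) in S.
  apply (is_series_ext _ (fun k => cos_weight k * (t ^ 2 / (t ^ 2 + (2 * PI * INR k) ^ 2)))) in S.
  - apply (is_series_ext (fun k => cos_weight (Datatypes.S k) *
        (t ^ 2 / (t ^ 2 + (2 * PI * INR (Datatypes.S k)) ^ 2)))).
    + intros k; change (cos_weight (Datatypes.S k)) with 2; as_real_eq; field.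
      generalize (Hden (2 * PI * INR (Datatypes.S k))); lra.
    + apply (is_series_incr_1 (fun k => cos_weight k * (t ^ 2 / (t ^ 2 + (2 * PI * INR k) ^ 2)))).
      match type of S with is_series _ ?l => match goal with |- is_series _ ?m => replace m with l end end;
        [exact S |].
      unfold phi, plus; simpl; unfold scal; simpl; unfold mult; simpl.
      replace (t * (1 / 2 - 0)) with (t / 2) by field.
      rewrite Hsh, Het; unfold cosh; rewrite exp_Ropp; fold e.
      field; repeat split; nra.
  - intros k; set (w := 2 * PI * INR k).
    assert (Sw : sin (w * (1 / 2)) = 0).
    { replace (w * (1 / 2)) with (INR k * PI) by (unfold w; field); apply sin_INR_PI. }
    specialize (Hden w).
    rewrite (is_RInt_unique (V := R_CompleteNormedModule) _ 0 (1 / 2) (2 * t * sinh (t / 2) / (t ^ 2 + w ^ 2))).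
    + unfold scal; simpl; unfold mult; simpl; as_real_eq; field; split; lra.
    (* An antiderivative of [2 * (phi x * cos (w * x))], found by integrating by parts twice. It
       vanishes at 1/2, since sin(w/2) = 0 and sinh 0 = 0. *)
    + set (F := fun x => 2 * (w * cosh (t * (1 / 2 - x)) * sin (w * x) - t * sinh (t * (1 / 2 - x)) * cos (w * x)) / (t ^ 2 + w ^ 2)).
      replace (2 * t * sinh (t / 2) / (t ^ 2 + w ^ 2)) with (minus (F (1 / 2)) (F 0)).
      * apply (is_RInt_derive (V := R_CompleteNormedModule)); intros x _.
        -- unfold F, phi, cosh, sinh; auto_derive; [exact I |].
           unfold Rminus; field; lra.
        -- apply (continuous_scal_r (V := R_NormedModule)).
           apply (continuous_mult (K := R_AbsRing) phi); [apply Cphi | apply cont_cos_lin].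
      * unfold F, minus, plus, opp; simpl plus.
        replace (t * (1 / 2 - 1 / 2)) with 0 by field.
        replace (t * (1 / 2 - 0)) with (t / 2) by field.
        rewrite Sw, sinh_0, !Rmult_0_r, sin_0, cos_0; unfold opp; simpl; field; simpl in Hden; lra.
Qed.

Lemma sin_add_INR_PI (x : R) (k : nat) : sin (x + INR k * PI) = (-1) ^ k * sin x.
Proof.
  induction k as [| k IH]; [simpl; rewrite Rmult_0_l, Rplus_0_r; ring |].
  rewrite S_INR; replace (x + (INR k + 1) * PI) with (x + INR k * PI + PI) by ring.
  rewrite neg_sin, IH; simpl; ring.
Qed.

Lemma pow_m1_sqr (k : nat) : (-1) ^ k * (-1) ^ k = 1.
Proof. rewrite <- Rpow_mult_distr; replace (-1 * -1) with 1 by ring; apply pow1. Qed.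

(** The cosine series of cos(2 PI v x) at x = 0: the product of cosines splits into frequencies v +
    k and v - k, whose integrals carry sin(PI(v+k)) and sin(PI(v-k)), both equal to (-1)^k sin(PI
    v). *)
Lemma csc_series (v : R) : 0 < v < 1 ->
  is_series (fun k => cos_weight k * ((-1) ^ k * (/ (v + INR k) + / (v - INR k)))) (2 * PI / sin (PI * v)).
Proof.
  intros Hv; assert (HPI := PI_RGT_0).
  assert (Hs : 0 < sin (PI * v)) by (apply sin_gt_0; nra).
  assert (Dphi : is_derive (fun x => cos (2 * PI * v * x)) 0 0).
  { auto_derive; [exact I |]; rewrite Rmult_0_r, sin_0; ring. }
  assert (S := cosine_series_at_0 _ _ (cont_cos_lin (2 * PI * v)) Dphi).
  apply (is_series_scal_l (2 * PI / sin (PI * v))) in S.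
  rewrite Rmult_0_r, cos_0 in S.
  replace (2 * PI / sin (PI * v)) with (scal (2 * PI / sin (PI * v)) 1) by apply Rmult_1_r.
  revert S; apply is_series_ext; intros k.
  assert (Hk1 : v + INR k <> 0) by (generalize (pos_INR k); lra).
  assert (Hk2 : v - INR k <> 0).
  { destruct k as [| k]; [simpl; lra |]; rewrite S_INR; generalize (pos_INR k); lra. }
  rewrite (RInt_ext_R _ (fun x => 1 * cos (2 * PI * (v + INR k) * x) + 1 * cos (2 * PI * (v - INR k) * x))).
  - rewrite RInt_lin by (apply cont_ex_RInt; intros; apply cont_cos_lin).
    rewrite !RInt_cos_half by (apply Rmult_integral_contrapositive_currified; auto; lra).
    replace (2 * PI * (v + INR k) / 2) with (PI * v + INR k * PI) by field.
    assert (E : sin (2 * PI * (v - INR k) / 2) = (-1) ^ k * sin (PI * v)).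
    { replace (PI * v) with (2 * PI * (v - INR k) / 2 + INR k * PI) by field.
      rewrite sin_add_INR_PI, <- Rmult_assoc, pow_m1_sqr; ring. }
    rewrite E, sin_add_INR_PI.
    unfold scal; simpl; unfold mult; simpl; as_real_eq; field; repeat split; auto; lra.
  - intros x _.
    replace (2 * PI * (v + INR k) * x) with (2 * PI * v * x + 2 * PI * INR k * x) by ring.
    replace (2 * PI * (v - INR k) * x) with (2 * PI * v * x - 2 * PI * INR k * x) by ring.
    rewrite cos_plus, cos_minus; ring.
Qed.

(** * The integral of the sech kernel, through alternating series *)

(* What remains of [exp (- p y) / (1 + exp (- 2 y))] after [n] terms of its expansion in
   powers of [exp (- 2 y)]. *)
Definition geom_tail (p : R) (n : nat) (y : R) : R :=
  (-1) ^ n * exp (- (2 * INR n + p) * y) / (1 + exp (-2 * y)).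

Lemma geom_tail_continuous p n y : continuous (geom_tail p n) y.
Proof.
  apply (ex_derive_continuous (V := R_NormedModule)); unfold geom_tail; auto_derive.
  generalize (exp_pos (-2 * y)); lra.
Qed.

Lemma RInt_exp_neg (c b : R) : c <> 0 -> RInt (fun y => exp (- c * y)) 0 b = (1 - exp (- c * b)) / c :> R.
Proof.
  intros Hc; apply is_RInt_unique.
  replace ((1 - exp (- c * b)) / c) with (minus (- exp (- c * b) / c) (- exp (- c * 0) / c)).
  - apply (is_RInt_derive (V := R_CompleteNormedModule) (fun y => - exp (- c * y) / c)); intros.
    + auto_derive; [exact I | field; exact Hc].
    + apply (ex_derive_continuous (V := R_NormedModule)); auto_derive; exact I.
  - unfold minus, plus, opp; simpl; rewrite Rmult_0_r, exp_0; field; exact Hc.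
Qed.

(** Consecutive tails differ by one exponential, whose integral over [0, b] is (-1)^m/(2m+p) up to
    an error of order exp(-pb). [K] may depend on [n], as b tends to infinity with n fixed. *)
Lemma geom_tail_partial (p : R) (n : nat) : 0 < p -> exists K, forall b, 0 <= b ->
  Rabs (RInt (geom_tail p 0) 0 b - RInt (geom_tail p (S n)) 0 b
        - sum_f_R0 (fun k => (-1) ^ k / (2 * INR k + p)) n) <= K * exp (- p * b).
Proof.
  intros Hp.
  assert (T : forall m b, RInt (geom_tail p m) 0 b - RInt (geom_tail p (S m)) 0 b =
            (-1) ^ m * ((1 - exp (- (2 * INR m + p) * b)) / (2 * INR m + p)) :> R).
  { intros m b; assert (N := pos_INR m).
    assert (E : RInt (geom_tail p m) 0 b =
      RInt (fun y => (-1) ^ m * exp (- (2 * INR m + p) * y) + 1 * geom_tail p (S m) y) 0 b :> R).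
    { apply RInt_ext_R; intros y _; unfold geom_tail; rewrite S_INR.
      replace (- (2 * (INR m + 1) + p) * y) with (- (2 * INR m + p) * y + -2 * y) by ring.
      rewrite exp_plus; simpl; field; generalize (exp_pos (-2 * y)); lra. }
    rewrite E, RInt_lin.
    - rewrite RInt_exp_neg by lra; ring.
    - apply cont_ex_RInt; intros y.
      apply (ex_derive_continuous (V := R_NormedModule)); auto_derive; exact I.
    - apply cont_ex_RInt, geom_tail_continuous. }
  assert (B : forall m b, 0 <= b -> Rabs (RInt (geom_tail p m) 0 b - RInt (geom_tail p (S m)) 0 b
      - (-1) ^ m / (2 * INR m + p)) <= / p * exp (- p * b)).
  { intros m b Hb; rewrite T; assert (N := pos_INR m).
    replace ((-1) ^ m * ((1 - exp (- (2 * INR m + p) * b)) / (2 * INR m + p)) - (-1) ^ m / (2 * INR m + p))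
      with ((-1) ^ m * - (exp (- (2 * INR m + p) * b) / (2 * INR m + p))) by (field; lra).
    rewrite Rabs_mult, pow_1_abs, Rmult_1_l, Rabs_Ropp, Rabs_pos_eq.
    - rewrite (Rmult_comm (/ p)); apply Rmult_le_compat.
      + left; apply exp_pos.
      + left; apply Rinv_0_lt_compat; lra.
      + apply exp_le_compat; nra.
      + apply Rinv_le_contravar; lra.
    - apply Rdiv_le_0_compat; [left; apply exp_pos | lra]. }
  induction n as [| n [K IH]].
  - exists (/ p); intros b Hb; apply B; exact Hb.
  - exists (K + / p); intros b Hb; specialize (IH b Hb); specialize (B (S n) b Hb).
    rewrite tech5.
    match type of IH with Rabs ?x <= _ => match type of B with Rabs ?y <= _ =>
      match goal with |- Rabs ?z <= _ => replace z with (x + y) by ring end end end.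
    eapply Rle_trans; [apply Rabs_triang | lra].
Qed.

Lemma geom_tail_bound (p : R) (n : nat) (b : R) : 0 < p -> 0 <= b ->
  Rabs (RInt (geom_tail p (S n)) 0 b) <= / INR (S n).
Proof.
  intros Hp Hb.
  assert (N : 0 < INR (S n)) by (apply lt_0_INR; lia).
  eapply Rle_trans; [apply (RInt_exp_bound _ 1 (- (2 * INR (S n) + p))); try lra |].
  - intros; apply geom_tail_continuous.
  - intros y _; unfold geom_tail, Rdiv; rewrite !Rabs_mult, pow_1_abs, Rmult_1_l.
    assert (E := exp_pos (-2 * y)); assert (E' := exp_pos (- (2 * INR (S n) + p) * y)).
    rewrite (Rabs_pos_eq (exp _)), Rabs_pos_eq by (left; try apply Rinv_0_lt_compat; lra).
    rewrite Rmult_comm; apply Rmult_le_compat_r; [lra |].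
    rewrite <- Rinv_1; apply Rinv_le_contravar; lra.
  - rewrite Rmult_0_r, exp_0.
    replace (1 / - (2 * INR (S n) + p) * (exp (- (2 * INR (S n) + p) * b) - 1)) with
      (/ (2 * INR (S n) + p) * (1 - exp (- (2 * INR (S n) + p) * b))) by (field; lra).
    rewrite <- (Rmult_1_r (/ INR (S n))).
    apply Rmult_le_compat.
    + left; apply Rinv_0_lt_compat; lra.
    + assert (exp (- (2 * INR (S n) + p) * b) <= exp 0) by (apply exp_le_compat; nra).
      rewrite exp_0 in *; lra.
    + apply Rinv_le_contravar; lra.
    + generalize (exp_pos (- (2 * INR (S n) + p) * b)); lra.
Qed.

(* [x ^ (2 v) / (1 + x ^ 2)] at [x = exp z]. *)
Definition sech_kernel (v z : R) : R := exp (2 * v * z) / (1 + exp (2 * z)).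

Lemma sech_kernel_continuous v z : continuous (sech_kernel v) z.
Proof.
  apply (ex_derive_continuous (V := R_NormedModule)); unfold sech_kernel; auto_derive.
  generalize (exp_pos (2 * z)); lra.
Qed.

(** The kernel behaves like exp(2vz) on the left and exp(-(2-2v)z) on the right, which gives the two
    constraints on [d]. *)
Lemma sech_kernel_dominated (v d : R) : 0 < d -> d <= 2 * v -> d <= 2 - 2 * v ->
  exp_dominated (sech_kernel v) 1 d.
Proof.
  intros Hd H1 H2 z; unfold sech_kernel, Rdiv.
  assert (E := exp_pos (2 * z)); assert (E' := exp_pos (2 * v * z)).
  rewrite Rmult_1_l, Rabs_pos_eq by
    (apply Rmult_le_pos; [lra | left; apply Rinv_0_lt_compat; lra]).
  apply Rmult_le_reg_r with (1 + exp (2 * z)); [lra |].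
  rewrite Rmult_assoc, Rinv_l, Rmult_1_r, Rmult_plus_distr_l, Rmult_1_r, <- exp_plus by lra.
  assert (X := exp_pos (- d * Rabs z)); assert (Y := exp_pos (- d * Rabs z + 2 * z)).
  destruct (Rle_dec 0 z) as [Hz | Hz].
  - rewrite (Rabs_pos_eq z) in * by lra.
    assert (exp (2 * v * z) <= exp (- d * z + 2 * z)) by (apply exp_le_compat; nra); lra.
  - rewrite (Rabs_left z) in * by lra.
    assert (exp (2 * v * z) <= exp (- d * - z)) by (apply exp_le_compat; nra); lra.
Qed.

(** Reflecting z on the negative half and factoring exp(2z) out of the denominator on the positive
    half bring both halves to the same geometric form, with exponents 2v and 2-2v. *)
Lemma RInt_sech_kernel (v b : R) :
  RInt (sech_kernel v) (- b) b = RInt (geom_tail (2 * v) 0) 0 b + RInt (geom_tail (2 - 2 * v) 0) 0 b :> R.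
Proof.
  rewrite <- (RInt_Chasles (V := R_CompleteNormedModule) _ (- b) 0 b)
    by (apply cont_ex_RInt, sech_kernel_continuous).
  unfold plus; simpl; f_equal.
  - rewrite <- (opp_RInt_swap (V := R_CompleteNormedModule))
      by apply cont_ex_RInt, sech_kernel_continuous.
    replace (RInt (sech_kernel v) 0 (- b)) with (RInt (sech_kernel v) (-1 * 0 + 0) (-1 * b + 0))
      by (f_equal; ring).
    rewrite <- (RInt_comp_lin (V := R_CompleteNormedModule))
      by (apply cont_ex_RInt, sech_kernel_continuous).
    rewrite <- (RInt_opp (V := R_CompleteNormedModule)).
    + apply RInt_ext_R; intros y _; unfold opp, scal; simpl; unfold mult; simpl.
      unfold sech_kernel, geom_tail; simpl.
      replace (2 * v * (-1 * y + 0)) with (- (2 * 0 + 2 * v) * y) by ring.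
      replace (2 * (-1 * y + 0)) with (-2 * y) by ring.
      field; generalize (exp_pos (-2 * y)); lra.
    + apply cont_ex_RInt; intros y.
      apply (continuous_scal_r (V := R_NormedModule)).
      apply (continuous_comp (fun y => -1 * y + 0) (sech_kernel v)); [| apply sech_kernel_continuous].
      apply (ex_derive_continuous (V := R_NormedModule)); auto_derive; exact I.
  - apply RInt_ext_R; intros y _; unfold sech_kernel, geom_tail; simpl.
    replace (- (2 * 0 + (2 - 2 * v)) * y) with (2 * v * y + -2 * y) by ring.
    rewrite exp_plus.
    replace (exp (2 * y)) with (/ exp (-2 * y)) by (rewrite <- exp_Ropp; f_equal; ring).
    assert (E := exp_pos (-2 * y)); field; lra.
Qed.

(** Each half expands into an alternating sum of 1/(2k+p), p = 2v and p = 2-2v. Together the two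
    sums regroup into a quarter of the partial fraction series of 2 PI / sin(PI v). *)
Lemma sech_kernel_integral (v : R) : 0 < v < 1 ->
  line_integral (sech_kernel v) (PI / (2 * sin (PI * v))).
Proof.
  intros Hv; assert (HPI := PI_RGT_0).
  assert (Hs : 0 < sin (PI * v)) by (apply sin_gt_0; nra).
  set (d := Rmin (2 * v) (2 - 2 * v)).
  assert (Hd : 0 < d) by (apply Rmin_glb_lt; lra).
  destruct (dominated_line_integral (sech_kernel v) 1 d (sech_kernel_continuous v)) as [J HJ]; auto.
  { apply sech_kernel_dominated; [exact Hd | apply Rmin_l | apply Rmin_r]. }
  set (A := fun p n => sum_f_R0 (fun k => (-1) ^ k / (2 * INR k + p)) n).
  assert (B : forall n, Rabs (A (2 * v) n + A (2 - 2 * v) n - J) <= 2 * / INR (S n)).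
  { intros n; apply le_epsilon; intros e He.
    destruct (geom_tail_partial (2 * v) n) as [K HK]; [lra |].
    destruct (geom_tail_partial (2 - 2 * v) n) as [L HL]; [lra |].
    assert (K0 : 0 <= K /\ 0 <= L).
    { specialize (HK 0 ltac:(lra)); specialize (HL 0 ltac:(lra)).
      rewrite Rmult_0_r, exp_0 in HK, HL.
      split; (eapply Rle_trans; [apply Rabs_pos |]); [rewrite <- (Rmult_1_r K) | rewrite <- (Rmult_1_r L)]; eassumption. }
    destruct (exp_decay_small K (2 * v) (e / 3)) as [M1 [_ H1]]; try lra.
    destruct (exp_decay_small L (2 - 2 * v) (e / 3)) as [M2 [_ H2]]; try lra.
    destruct (HJ (e / 3)) as [M3 H3]; [lra |].
    set (b := Rmax 0 (Rmax M1 (Rmax M2 M3)) + 1).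
    assert (Hb : 0 < b /\ M1 < b /\ M2 < b /\ M3 < b).
    { unfold b; generalize (Rmax_l 0 (Rmax M1 (Rmax M2 M3))) (Rmax_r 0 (Rmax M1 (Rmax M2 M3)))
        (Rmax_l M1 (Rmax M2 M3)) (Rmax_r M1 (Rmax M2 M3)) (Rmax_l M2 M3) (Rmax_r M2 M3).
      intros; repeat split; lra. }
    specialize (HK b ltac:(lra)); specialize (HL b ltac:(lra)).
    specialize (H1 b ltac:(lra)); specialize (H2 b ltac:(lra)).
    specialize (H3 (- b) b ltac:(lra) ltac:(lra)).
    rewrite RInt_sech_kernel in H3.
    assert (G1 := geom_tail_bound (2 * v) n b ltac:(lra) ltac:(lra)).
    assert (G2 := geom_tail_bound (2 - 2 * v) n b ltac:(lra) ltac:(lra)).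
    fold (A (2 * v) n) in HK; fold (A (2 - 2 * v) n) in HL.
    set (g1 := RInt (geom_tail (2 * v) 0) 0 b) in *; set (g2 := RInt (geom_tail (2 - 2 * v) 0) 0 b) in *.
    set (h1 := RInt (geom_tail (2 * v) (S n)) 0 b) in *; set (h2 := RInt (geom_tail (2 - 2 * v) (S n)) 0 b) in *.
    replace (A (2 * v) n + A (2 - 2 * v) n - J) with
      (- (g1 - h1 - A (2 * v) n) + (- (g2 - h2 - A (2 - 2 * v) n) + ((g1 + g2 - J) + (- h1 + - h2)))) by ring.
    eapply Rle_trans; [apply Rabs_triang |]; rewrite Rabs_Ropp.
    assert (T1 := Rabs_triang (- (g2 - h2 - A (2 - 2 * v) n)) ((g1 + g2 - J) + (- h1 + - h2))).
    assert (T2 := Rabs_triang (g1 + g2 - J) (- h1 + - h2)).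
    assert (T3 := Rabs_triang (- h1) (- h2)).
    rewrite Rabs_Ropp in T1; rewrite !Rabs_Ropp in T3; lra. }
  assert (Linv : is_lim_seq (fun n => / INR (S n)) 0).
  { apply (is_lim_seq_incr_1 (fun n => / INR n)).
    apply (is_lim_seq_inv _ p_infty); [apply is_lim_seq_INR | discriminate]. }
  assert (LA : is_lim_seq (fun n => A (2 * v) n + A (2 - 2 * v) n) J).
  { apply is_lim_seq_le_le with (fun n => J - 2 * / INR (S n)) (fun n => J + 2 * / INR (S n)).
    - intros n; specialize (B n); apply Rabs_le_between in B; lra.
    - replace (Finite J) with (Finite (J - 2 * 0)) by (f_equal; ring).
      apply is_lim_seq_minus'; [apply is_lim_seq_const | now apply (is_lim_seq_scal_l _ 2 0)].
    - replace (Finite J) with (Finite (J + 2 * 0)) by (f_equal; ring).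
      apply is_lim_seq_plus'; [apply is_lim_seq_const | now apply (is_lim_seq_scal_l _ 2 0)]. }
  set (P := fun n => sum_f_R0 (fun k => cos_weight k * ((-1) ^ k * (/ (v + INR k) + / (v - INR k)))) n).
  (* Since (-1)^k/(v-k) = (-1)^(k-1)/(k-v), term k-1 of the second sum pairs with index k of the
     cosecant series. This shift leaves the last term of the second sum unpaired; it tends to 0. *)
  assert (E : forall n, A (2 * v) n + A (2 - 2 * v) n =
            / 4 * P n + / 2 * ((-1) ^ n * / (INR n + 1 - v))).
  { unfold A, P; induction n as [| n IH].
    - simpl; field; lra.
    - rewrite !tech5.
      match goal with |- (?x + ?a) + (?y + ?b) = _ =>
        replace (x + a + (y + b)) with ((x + y) + (a + b)) by ring end.
      rewrite IH, S_INR; change (cos_weight (S n)) with 2; simpl pow.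
      assert (N := pos_INR n); field; lra. }
  assert (LP : is_lim_seq P (2 * PI / sin (PI * v))).
  { assert (S := csc_series v Hv); apply is_series_Reals in S; now apply is_lim_seq_Reals. }
  assert (LQ : is_lim_seq (fun n => (-1) ^ n * / (INR n + 1 - v)) 0).
  { apply is_lim_seq_abs_0.
    apply is_lim_seq_ext with (fun n => / (INR n + (1 - v))).
    - intros n; rewrite Rabs_mult, pow_1_abs, Rmult_1_l, Rabs_pos_eq.
      + f_equal; ring.
      + left; apply Rinv_0_lt_compat; generalize (pos_INR n); lra.
    - apply (is_lim_seq_inv _ p_infty); [| discriminate].
      apply is_lim_seq_plus with p_infty (1 - v); [apply is_lim_seq_INR | apply is_lim_seq_const | reflexivity]. }
  assert (LE : is_lim_seq (fun n => A (2 * v) n + A (2 - 2 * v) n) (/ 4 * (2 * PI / sin (PI * v)) + / 2 * 0)).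
  { apply is_lim_seq_ext with (fun n => / 4 * P n + / 2 * ((-1) ^ n * / (INR n + 1 - v))).
    - intros; symmetry; apply E.
    - apply is_lim_seq_plus'.
      + now apply (is_lim_seq_scal_l _ (/ 4) (2 * PI / sin (PI * v))).
      + now apply (is_lim_seq_scal_l _ (/ 2) 0). }
  apply is_lim_seq_unique in LA; apply is_lim_seq_unique in LE.
  rewrite LA in LE; injection LE as LE.
  replace (PI / (2 * sin (PI * v))) with J; [exact HJ |].
  rewrite LE; field; lra.
Qed.

(** * The Mellin transform of mu_fun *)

Lemma nonneg_of_derive (f df : R -> R) :
  (forall x, is_derive f x (df x)) -> (forall x, 0 <= x -> 0 <= df x) -> 0 <= f 0 ->
  forall x, 0 <= x -> 0 <= f x.
Proof.
  intros D P F0 x Hx.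
  destruct (MVT_gen f 0 x df) as [c [Hc E]].
  - intros; apply D.
  - intros y _; apply continuity_pt_filterlim.
    apply (ex_derive_continuous (V := R_NormedModule)); exists (df y); apply D.
  - rewrite Rmin_left, Rmax_right in Hc by lra.
    assert (0 <= df c) by (apply P; lra); nra.
Qed.

Lemma is_derive_cosh x : is_derive cosh x (sinh x).
Proof. unfold cosh, sinh; auto_derive; [exact I | field]. Qed.

Lemma is_derive_sinh x : is_derive sinh x (cosh x).
Proof. unfold cosh, sinh; auto_derive; [exact I | field]. Qed.

Lemma cosh_ge_1 x : 1 <= cosh x.
Proof.
  unfold cosh; rewrite exp_Ropp; assert (E := exp_pos x).
  apply Rmult_le_reg_r with (2 * exp x); [lra |].
  replace ((exp x + / exp x) / 2 * (2 * exp x)) with (exp x * exp x + 1) by (field; lra).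
  generalize (Rle_0_sqr (exp x - 1)); unfold Rsqr; lra.
Qed.

Lemma sinh_ge_id x : 0 <= x -> x <= sinh x.
Proof.
  intros Hx; assert (0 <= sinh x - x); [| lra].
  apply (nonneg_of_derive (fun x => sinh x - x) (fun x => cosh x - 1)); auto.
  - intros y; apply (is_derive_minus (V := R_NormedModule) sinh (fun x => x));
      [apply is_derive_sinh | apply (is_derive_id (K := R_AbsRing))].
  - intros y _; generalize (cosh_ge_1 y); lra.
  - rewrite sinh_0; lra.
Qed.

(** Obtained by repeated integration from cosh >= 1. The quartic term is what gives [mu_fun] its
    decay of order 1/t^2 below. *)
Lemma cosh_ge_quartic x : 0 <= x -> 1 + x ^ 2 / 2 + x ^ 4 / 24 <= cosh x.
Proof.
  assert (A : forall x, 0 <= x -> 0 <= cosh x - (1 + x ^ 2 / 2)).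
  { apply nonneg_of_derive with (fun x => sinh x - x).
    - intros y; apply (is_derive_minus (V := R_NormedModule) cosh (fun x => 1 + x ^ 2 / 2));
        [apply is_derive_cosh | auto_derive; [exact I | simpl; field]].
    - intros y Hy; generalize (sinh_ge_id y Hy); lra.
    - rewrite cosh_0; lra. }
  assert (B : forall x, 0 <= x -> 0 <= sinh x - (x + x ^ 3 / 6)).
  { apply nonneg_of_derive with (fun x => cosh x - (1 + x ^ 2 / 2)); [| exact A |].
    - intros y; apply (is_derive_minus (V := R_NormedModule) sinh (fun x => x + x ^ 3 / 6));
        [apply is_derive_sinh | auto_derive; [exact I | simpl; field]].
    - rewrite sinh_0; lra. }
  intros Hx; assert (0 <= cosh x - (1 + x ^ 2 / 2 + x ^ 4 / 24)); [| lra].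
  revert x Hx; apply nonneg_of_derive with (fun x => sinh x - (x + x ^ 3 / 6)); [| exact B |].
  - intros y; apply (is_derive_minus (V := R_NormedModule) cosh (fun x => 1 + x ^ 2 / 2 + x ^ 4 / 24));
      [apply is_derive_cosh | auto_derive; [exact I | simpl; field]].
  - rewrite cosh_0; lra.
Qed.

(** * Bounds for Q' and Q'', and the double integration by parts *)

Definition bose (t : R) : R := t / (exp t - 1) + t / 2 - 1.
Definition dbose (t : R) : R := / (exp t - 1) - t * exp t / (exp t - 1) ^ 2 + 1 / 2.

Lemma exp_gt_1 t : 0 < t -> 1 < exp t.
Proof. intros; rewrite <- exp_0; now apply exp_increasing. Qed.

Lemma is_derive_bose t : 0 < t -> is_derive bose t (dbose t).
Proof.
  intros Ht; assert (E := exp_gt_1 t Ht); unfold bose, dbose.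
  auto_derive; [lra | field; lra].
Qed.

Lemma is_derive_dbose t : 0 < t -> is_derive dbose t (mu_fun t).
Proof.
  intros Ht; assert (E := exp_gt_1 t Ht); unfold dbose, mu_fun.
  replace (exp (2 * t)) with (exp t * exp t) by (rewrite <- exp_plus; f_equal; ring).
  auto_derive; [split; [lra | split; [nra | exact I]] | field; lra].
Qed.

Lemma exp_cosh_sinh t : exp t * (2 * cosh t) = exp t * exp t + 1 /\ exp t * (2 * sinh t) = exp t * exp t - 1.
Proof.
  unfold cosh, sinh; rewrite exp_Ropp; assert (E := exp_pos t); split; field; lra.
Qed.

(** These control the boundary term t^(-u) Q'(t): the bound 1 at infinity, the bound t at 0.
    Multiplied by (e^t-1)^2 = 2 e^t (cosh t - 1), Q' becomes e^t (sinh t - t). *)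
Lemma dbose_bounds t : 0 < t -> 0 <= dbose t <= Rmin 1 t.
Proof.
  intros Ht; assert (E := exp_gt_1 t Ht).
  destruct (exp_cosh_sinh t) as [Hc Hs].
  assert (S := sinh_ge_id t ltac:(lra)).
  assert (X : dbose t * (exp t - 1) ^ 2 = exp t * (sinh t - t)).
  { unfold dbose; replace (exp t * (sinh t - t)) with ((exp t * exp t - 1) / 2 - t * exp t) by lra.
    field; lra. }
  assert (D : 0 < (exp t - 1) ^ 2) by (apply pow_lt; lra).
  assert (D' : (exp t - 1) ^ 2 = exp t * (2 * (cosh t - 1))) by (simpl; lra).
  split.
  - apply Rmult_le_reg_r with ((exp t - 1) ^ 2); [exact D |].
    rewrite X, Rmult_0_l; apply Rmult_le_pos; lra.
  - apply Rmin_glb.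
    + assert (Y : 1 - t <= exp (- t)) by (generalize (exp_ineq1_le (- t)); lra).
      rewrite exp_Ropp in Y.
      apply Rmult_le_reg_r with ((exp t - 1) ^ 2); [exact D |].
      unfold dbose; replace ((/ (exp t - 1) - t * exp t / (exp t - 1) ^ 2 + 1 / 2) * (exp t - 1) ^ 2)
        with (exp t - 1 - t * exp t + / 2 * (exp t - 1) ^ 2) by (field; lra).
      assert (exp t * (1 - t) <= exp t * / exp t) by (apply Rmult_le_compat_l; lra).
      rewrite Rinv_r in * by lra; lra.
    + assert (Y : 0 <= 2 * t * (cosh t - 1) - (sinh t - t)).
      { apply (nonneg_of_derive (fun t => 2 * t * (cosh t - 1) - (sinh t - t))
          (fun t => (cosh t - 1) + 2 * t * sinh t)).
        - intros x; unfold cosh, sinh; auto_derive; [exact I | field].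
        - intros x Hx; generalize (cosh_ge_1 x) (sinh_ge_id x Hx); nra.
        - rewrite cosh_0, sinh_0; lra.
        - lra. }
      apply Rmult_le_reg_r with ((exp t - 1) ^ 2); [exact D |].
      rewrite X, D'; assert (0 <= exp t * (2 * t * (cosh t - 1) - (sinh t - t)))
        by (apply Rmult_le_pos; lra); lra.
Qed.

(** Over the common denominator (e^t-1)^3 the numerator is e^t [N] with 0 <= N <= t^2 (e^t-1)/2.
    This leaves t^2/(4(cosh t - 1)), bounded through the quartic minorant of cosh; 12 is a
    convenient constant, not a sharp one. *)
Lemma mu_fun_bounds t : 0 < t -> 0 <= mu_fun t <= 12 / (1 + t ^ 2).
Proof.
  intros Ht; assert (E := exp_gt_1 t Ht).
  destruct (exp_cosh_sinh t) as [Hc _].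
  set (N := (t - 2) * exp t + t + 2).
  assert (N0 : 0 <= N).
  { apply (nonneg_of_derive (fun t => (t - 2) * exp t + t + 2) (fun t => (t - 1) * exp t + 1)); try lra.
    - intros x; auto_derive; [exact I | ring].
    - apply (nonneg_of_derive _ (fun t => t * exp t)).
      + intros x; auto_derive; [exact I | ring].
      + intros x Hx; apply Rmult_le_pos; [exact Hx | left; apply exp_pos].
      + rewrite exp_0; lra.
    - rewrite exp_0; lra. }
  assert (N1 : 0 <= t ^ 2 * (exp t - 1) / 2 - N).
  { apply (nonneg_of_derive (fun t => t ^ 2 * (exp t - 1) / 2 - ((t - 2) * exp t + t + 2))
       (fun t => t ^ 2 * exp t / 2 + (exp t - 1 - t))); try lra.
    - intros x; auto_derive; [exact I | simpl; field].
    - intros x Hx; assert (P := exp_pos x); assert (Q := exp_ineq1_le x).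
      assert (0 <= x ^ 2) by (simpl; nra); nra.
    - rewrite exp_0; simpl; lra. }
  assert (X : mu_fun t = exp t * N / (exp t - 1) ^ 3).
  { unfold mu_fun, N; replace (exp (2 * t)) with (exp t * exp t) by (rewrite <- exp_plus; f_equal; ring).
    field; lra. }
  assert (D : 0 < exp t - 1) by lra.
  rewrite X; split.
  - apply Rdiv_le_0_compat; [nra | now apply pow_lt].
  - assert (C := cosh_ge_quartic t ltac:(lra)).
    apply Rle_trans with (exp t * (t ^ 2 * (exp t - 1) / 2) / (exp t - 1) ^ 3).
    + apply Rmult_le_compat_r; [left; apply Rinv_0_lt_compat; now apply pow_lt |].
      apply Rmult_le_compat_l; lra.
    + replace (exp t * (t ^ 2 * (exp t - 1) / 2) / (exp t - 1) ^ 3) with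
        (t ^ 2 * exp t / (2 * (exp t - 1) ^ 2)) by (field; lra).
      replace ((exp t - 1) ^ 2) with (exp t * (2 * (cosh t - 1))) by (simpl; lra).
      assert (T : 0 < t ^ 2) by now apply pow_lt.
      replace (t ^ 2 * exp t / (2 * (exp t * (2 * (cosh t - 1))))) with
        (t ^ 2 / (4 * (cosh t - 1))) by (field; split; nra).
      apply Rmult_le_reg_r with (4 * (cosh t - 1) * (1 + t ^ 2)); [apply Rmult_lt_0_compat; nra |].
      replace (t ^ 2 / (4 * (cosh t - 1)) * (4 * (cosh t - 1) * (1 + t ^ 2))) with (t ^ 2 * (1 + t ^ 2))
        by (field; nra).
      replace (12 / (1 + t ^ 2) * (4 * (cosh t - 1) * (1 + t ^ 2))) with (48 * (cosh t - 1)) by (field; nra).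
      replace (t ^ 4) with (t ^ 2 * t ^ 2) in C by ring. nra.
Qed.

(** The second factor is the Jacobian of t = exp y. *)
Definition mu_log (y : R) : R := mu_fun (exp y) * exp y.

Lemma mu_log_continuous y : continuous mu_log y.
Proof.
  apply (ex_derive_continuous (V := R_NormedModule)); unfold mu_log, mu_fun; auto_derive.
  assert (E := exp_gt_1 (exp y) (exp_pos y)).
  split; [| split; [| exact I]].
  - apply Rgt_not_eq, Rmult_lt_0_compat; lra.
  - apply Rgt_not_eq; repeat apply Rmult_lt_0_compat; lra.
Qed.

(** The function t/(1+t^2) is at most both t and 1/t, that is exp(-|y|) for t = exp y. *)
Lemma mu_log_dominated : exp_dominated mu_log 12 1.
Proof.
  intros y; unfold mu_log; assert (E := exp_pos y).
  destruct (mu_fun_bounds (exp y) E) as [B0 B1].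
  rewrite Rabs_pos_eq by (apply Rmult_le_pos; lra).
  assert (T : 0 < 1 + exp y ^ 2) by nra.
  apply Rle_trans with (12 * (exp y / (1 + exp y ^ 2))).
  { replace (12 * (exp y / (1 + exp y ^ 2))) with (12 / (1 + exp y ^ 2) * exp y) by (field; lra).
    apply Rmult_le_compat_r; lra. }
  apply Rmult_le_compat_l; [lra |].
  apply Rmult_le_reg_r with (1 + exp y ^ 2); [exact T |].
  replace (exp y / (1 + exp y ^ 2) * (1 + exp y ^ 2)) with (exp y) by (field; lra).
  destruct (Rle_dec 0 y) as [Hy | Hy].
  - rewrite Rabs_pos_eq by lra; replace (- (1) * y) with (- y) by ring; rewrite exp_Ropp.
    replace (/ exp y * (1 + exp y ^ 2)) with (/ exp y + exp y) by (field; lra).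
    generalize (Rinv_0_lt_compat _ E); lra.
  - rewrite Rabs_left by lra; replace (- (1) * - y) with y by ring; nra.
Qed.

Lemma exp_dominated_twist (f : R -> R) (C d u : R) : 0 <= u -> exp_dominated f C d ->
  exp_dominated (fun y => f y * exp (- u * y)) C (d - u).
Proof.
  intros Hu Hf y; assert (HC := exp_dominated_pos _ _ _ Hf); specialize (Hf y).
  rewrite Rabs_mult, (Rabs_pos_eq (exp _)) by (left; apply exp_pos).
  apply Rle_trans with (C * exp (- d * Rabs y) * exp (- u * y)).
  - apply Rmult_le_compat_r; [left; apply exp_pos | exact Hf].
  - rewrite Rmult_assoc, <- exp_plus; apply Rmult_le_compat_l; [exact HC |].
    apply exp_le_compat; generalize (Rle_abs (- y)); rewrite Rabs_Ropp; nra.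
Qed.

(* The boundary terms of the two integrations by parts are collected in
   [t^(-u) bose' t + u t^(-u-1) bose t] with [t = exp y]. *)
Lemma mu_log_by_parts (u C d l m : R) : 0 < u < 1 ->
  exp_dominated (fun y => exp (- (u + 1) * y) * bose (exp y)) C d -> 0 < d ->
  line_integral (fun y => mu_log y * exp (- u * y)) l ->
  line_integral (fun y => exp (- (u + 1) * y) * bose (exp y)) m ->
  l = u * (u + 1) * m.
Proof.
  intros Hu HQ Hd Hl Hm.
  set (B := fun y => exp (- (u + 1) * y) * bose (exp y)) in *.
  assert (HC := exp_dominated_pos _ _ _ HQ).
  (* In the derivative the [dbose] contributions of the two summands cancel, so both integrations by
     parts are done at once. *)
  refine (line_integral_of_derivative (fun y => exp (- u * y) * dbose (exp y) + u * B y) _ _ _ _ _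
    _ _ _ _ Hl Hm).
  - intros y; apply (continuous_mult (K := R_AbsRing) mu_log); [apply mu_log_continuous |].
    apply (ex_derive_continuous (V := R_NormedModule)); auto_derive; exact I.
  - intros y; apply (ex_derive_continuous (V := R_NormedModule)); unfold B, bose; auto_derive.
    generalize (exp_gt_1 (exp y) (exp_pos y)); lra.
  - intros y; assert (E := exp_pos y).
    assert (D1 := is_derive_bose (exp y) E); assert (D2 := is_derive_dbose (exp y) E).
    unfold B; auto_derive.
    + repeat split; try exact I; eexists; [exact D2 | exact D1].
    + replace (Derive (fun x : R => bose x) (exp y)) with (dbose (exp y))
        by (symmetry; now apply is_derive_unique).
      replace (Derive (fun x : R => dbose x) (exp y)) with (mu_fun (exp y))
        by (symmetry; now apply is_derive_unique).
      unfold mu_log.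
      replace (- u * y) with (- (u + 1) * y + y) by ring; rewrite exp_plus; ring.
  - intros e He.
    (* Three decay rates: u on the right, where Q' <= 1; 1-u on the left, where Q' <= t; and [d] for
       the summand [u * B y]. *)
    destruct (exp_decay_small 1 u (e / 2)) as [M1 [P1 H1]]; try lra.
    destruct (exp_decay_small 1 (1 - u) (e / 2)) as [M2 [P2 H2]]; try lra.
    destruct (exp_decay_small (u * C) d (e / 2)) as [M3 [P3 H3]]; try lra; [nra |].
    exists (Rmax M1 (Rmax M2 M3)); intros y Hy.
    assert (X1 := Rmax_l M1 (Rmax M2 M3)); assert (X2 := Rmax_r M1 (Rmax M2 M3)).
    assert (X3 := Rmax_l M2 M3); assert (X4 := Rmax_r M2 M3).
    specialize (H1 (Rabs y) ltac:(lra)); specialize (H2 (Rabs y) ltac:(lra)); specialize (H3 (Rabs y) ltac:(lra)).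
    destruct (dbose_bounds (exp y) (exp_pos y)) as [D0 D1].
    assert (D2 := Rmin_l 1 (exp y)); assert (D3 := Rmin_r 1 (exp y)).
    assert (E := exp_pos (- u * y)).
    eapply Rle_lt_trans; [apply Rabs_triang |].
    assert (Rabs (u * B y) < e / 2).
    { rewrite Rabs_mult, (Rabs_pos_eq u) by lra; specialize (HQ y).
      assert (u * Rabs (B y) <= u * (C * exp (- d * Rabs y))) by (apply Rmult_le_compat_l; lra); lra. }
    assert (Rabs (exp (- u * y) * dbose (exp y)) < e / 2); [| lra].
    rewrite Rabs_pos_eq by (apply Rmult_le_pos; lra).
    destruct (Rle_dec 0 y) as [Hy0 | Hy0].
    + rewrite Rabs_pos_eq in H1 by lra; nra.
    + rewrite (Rabs_left y) in * by lra.
      assert (exp (- u * y) * dbose (exp y) <= exp (- u * y) * exp y) by (apply Rmult_le_compat_l; lra).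
      rewrite <- exp_plus in *; replace (- (1 - u) * - y) with (- u * y + y) in H2 by ring; lra.
Qed.

(** * Zeta at 1 + u as an integral *)

(** Comparison with a telescoping series: (x-1)^(-d) - x^(-d) >= d x^(-1-d), from ln(1 - 1/x) <=
    -1/x and exp r >= 1 + r. *)
Lemma ex_series_power (d : R) : 0 < d -> ex_series (fun k => Rpower (INR (S k)) (- (1 + d))).
Proof.
  intros Hd.
  (* The first term is dropped so that x - 1 stays positive and its logarithm makes sense. *)
  apply (ex_series_incr_1 (fun k => Rpower (INR (S k)) (- (1 + d)))).
  set (a := fun k => Rpower (INR (S k)) (- d)).
  assert (La : is_lim_seq a 0).
  { apply is_lim_seq_spec; intros eps.
    destruct (exp_decay_small 1 d eps) as [M [_ HM]]; [lra | exact Hd | apply cond_pos |].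
    destruct (INR_unbounded (exp M)) as [N HN]; exists N; intros n Hn.
    unfold a, Rpower; rewrite Rminus_0_r, Rabs_pos_eq by (left; apply exp_pos).
    specialize (HM (ln (INR (S n)))); rewrite Rmult_1_l in HM; apply HM.
    rewrite <- (ln_exp M); left; apply ln_increasing; [apply exp_pos |].
    assert (Q := le_INR _ _ Hn); rewrite S_INR; lra. }
  apply (ex_series_le (V := R_CompleteNormedModule) _ (fun k => / d * (a k - a (S k)))).
  - intros k; change (Rabs (Rpower (INR (S (S k))) (- (1 + d))) <= / d * (a k - a (S k))).
    unfold a, Rpower.
    rewrite Rabs_pos_eq by (left; apply exp_pos).
    set (x := INR (S (S k))).
    assert (Hx : 1 < x) by (unfold x; rewrite 2!S_INR; generalize (pos_INR k); lra).
    assert (E : INR (S k) = x * (1 - / x)) by (unfold x; rewrite (S_INR (S k)); field; rewrite <- S_INR; fold x; lra).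
    assert (Ix : 0 < / x < 1) by (split; [apply Rinv_0_lt_compat; lra | rewrite <- Rinv_1; apply Rinv_lt_contravar; lra]).
    rewrite E, ln_mult by lra.
    assert (Lx : ln (1 - / x) <= - / x).
    { rewrite <- (ln_exp (- / x)); apply ln_le; [lra |].
      generalize (exp_ineq1_le (- / x)); lra. }
    replace (- d * (ln x + ln (1 - / x))) with (- d * ln x + - d * ln (1 - / x)) by ring.
    replace (- (1 + d) * ln x) with (- d * ln x + - ln x) by ring.
    rewrite !exp_plus, exp_Ropp, exp_ln by lra.
    assert (P := exp_pos (- d * ln x)).
    assert (Q := exp_ineq1_le (- d * ln (1 - / x))).
    assert (R : d * / x <= - d * ln (1 - / x)) by nra.
    apply Rmult_le_reg_l with d; [exact Hd |].
    rewrite <- (Rmult_assoc d (/ d)), Rinv_r, Rmult_1_l by lra.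
    replace (d * (exp (- d * ln x) * / x)) with (exp (- d * ln x) * (d * / x)) by ring.
    nra.
  - exists (/ d * (a O - 0)); apply (is_series_scal_l (V := R_NormedModule) (/ d) (fun k => a k - a (S k))).
    apply is_series_of_lim.
    apply is_lim_seq_ext with (fun n => a O - a (S n)).
    + induction n as [| n IH]; [reflexivity | rewrite tech5, <- IH; ring].
    + apply is_lim_seq_minus'; [apply is_lim_seq_const | now apply -> is_lim_seq_incr_1].
Qed.

(** The sum [z] is produced here together with the integral: termwise integration shows that the
    series of K (k+1)^(-1-u) converges to [L], whence z = L/K. *)
Lemma zeta_mellin (u : R) : 0 < u < 1 / 2 -> exists z l,
  is_series (fun k => Rpower (INR (S k)) (- (1 + u))) z /\
  line_integral (fun y => mu_log y * exp (- u * y)) l /\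
  u * (1 + u) * z = 2 * (exp (u * ln (2 * PI)) * cos (PI / 2 * u)) * l.
Proof.
  intros Hu; assert (HPI := PI_RGT_0); assert (HPI2 := PI2_1).
  (* Chosen so that x^(2v) dx/x = x^(-u) dx; it also gives sin(PI v) = cos(PI u / 2). *)
  set (v := (1 - u) / 2).
  assert (Hs : 0 < sin (PI * v)) by (apply sin_gt_0; unfold v; nra).
  set (J := PI / (2 * sin (PI * v))).
  assert (HJ : 0 < J) by (apply Rdiv_lt_0_compat; lra).
  set (h := fun k => ln (2 * PI * INR (S k))).
  assert (Hk : forall k, 1 <= INR (S k)) by (intros k; rewrite S_INR; generalize (pos_INR k); lra).
  assert (Eh : forall k, exp (h k) = 2 * PI * INR (S k)).
  { intros k; apply exp_ln; specialize (Hk k); nra. }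
  assert (Lh : forall k, h k = ln (2 * PI) + ln (INR (S k))).
  { intros k; apply ln_mult; [lra | specialize (Hk k); lra]. }
  assert (Hh : forall k, 0 <= h k).
  { intros k; unfold h; rewrite <- ln_1; apply ln_le; [lra | specialize (Hk k); nra]. }
  set (f := fun k y => 2 * exp (- (1 + u) * h k) * sech_kernel v (y - h k)).
  set (F := fun y => exp (- (u + 1) * y) * bose (exp y)).
  (* Recentring exp(-(u/2)|y - h_k|) at 0 costs exp((u/2) h_k). Half of the exponent u is spent on
     this, and the remaining 1 + u/2 keeps the dominating series convergent. *)
  set (b := fun k => 2 * exp (- (1 + u / 2) * h k)).
  assert (Csh : forall k y, continuous (fun y => sech_kernel v (y - h k)) y).
  { intros k y; apply (continuous_comp (fun y => y - h k) (sech_kernel v)); [| apply sech_kernel_continuous].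
    apply (ex_derive_continuous (V := R_NormedModule)); auto_derive; exact I. }
  assert (Sb : ex_series b).
  { destruct (ex_series_power (u / 2)) as [s Hsum]; [lra |].
    exists (2 * exp (- (1 + u / 2) * ln (2 * PI)) * s).
    apply (is_series_scal_l (V := R_NormedModule) (2 * exp (- (1 + u / 2) * ln (2 * PI)))) in Hsum.
    revert Hsum; apply is_series_ext; intros k; unfold b, Rpower, scal; simpl; unfold mult; simpl.
    change (match k with O => 1 | S _ => INR k + 1 end) with (INR (S k)).
    rewrite Lh, Rmult_plus_distr_l, exp_plus; as_real_eq; ring. }
  destruct Sb as [Bsum HB].
  destruct (line_integral_series f F b (fun k => 2 * exp (- (1 + u) * h k) * J) Bsum (u / 2)) as [DF [L [HL SL]]].
  - intros k y; apply (continuous_scal_r (V := R_NormedModule)), Csh.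
  - intros y; apply (ex_derive_continuous (V := R_NormedModule)); unfold F, bose; auto_derive.
    generalize (exp_gt_1 (exp y) (exp_pos y)); lra.
  - lra.
  - intros k y; unfold f, b.
    assert (D := sech_kernel_dominated v (u / 2) ltac:(lra) ltac:(unfold v; lra) ltac:(unfold v; lra) (y - h k)).
    assert (P := exp_pos (- (1 + u) * h k)).
    rewrite Rabs_mult, (Rabs_pos_eq (2 * _)) by lra.
    apply Rle_trans with (2 * exp (- (1 + u) * h k) * (1 * exp (- (u / 2) * Rabs (y - h k)))).
    + apply Rmult_le_compat_l; lra.
    + rewrite Rmult_1_l, 2!Rmult_assoc, <- 2!exp_plus.
      apply Rmult_le_compat_l; [lra |]; apply exp_le_compat.
      assert (T := Rabs_triang (y - h k) (h k)); replace (y - h k + h k) with y in T by ring.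
      rewrite (Rabs_pos_eq (h k)) in T by apply Hh; nra.
  - exact HB.
  - intros y; assert (Q := coth_series (exp y) (exp_pos y)).
    apply (is_series_scal_l (V := R_NormedModule) (exp (- (u + 1) * y))) in Q.
    revert Q; apply is_series_ext; intros k; unfold f, sech_kernel, scal; simpl; unfold mult; simpl.
    change (match k with O => 1 | S _ => INR k + 1 end) with (INR (S k)).
    rewrite <- Eh.
    replace (2 * v * (y - h k)) with (- (u + 1) * y + (1 + u) * h k + (y + y) + - (h k + h k))
      by (unfold v; field).
    replace (2 * (y - h k)) with ((y + y) + - (h k + h k)) by ring.
    replace (- (1 + u) * h k) with (- ((1 + u) * h k)) by ring.
    rewrite !exp_plus, !exp_Ropp, !exp_plus.
    assert (P1 := exp_pos (h k)); assert (P2 := exp_pos y); assert (P3 := exp_pos ((1 + u) * h k)).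
    as_real_eq; field; repeat split; nra.
  - intros k; apply line_integral_scal; [apply Csh |].
    apply (line_integral_shift (sech_kernel v)); [apply sech_kernel_continuous |].
    apply sech_kernel_integral; unfold v; lra.
  - assert (Cm : forall y, continuous (fun y => mu_log y * exp (- u * y)) y).
    { intros y; apply (continuous_mult (K := R_AbsRing) mu_log); [apply mu_log_continuous |].
      apply (ex_derive_continuous (V := R_NormedModule)); auto_derive; exact I. }
    destruct (dominated_line_integral (fun y => mu_log y * exp (- u * y)) 12 (1 - u)) as [l Hl];
      [exact Cm | apply exp_dominated_twist; [lra | apply mu_log_dominated] | lra |].
    assert (EL := mu_log_by_parts u _ _ _ _ ltac:(lra) DF ltac:(lra) Hl HL).
    set (K := 2 * exp (- (1 + u) * ln (2 * PI)) * J).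
    assert (HK : 0 < K) by (unfold K; generalize (exp_pos (- (1 + u) * ln (2 * PI))); nra).
    exists (/ K * L), l; repeat split; [| exact Hl |].
    + apply (is_series_scal_l (V := R_NormedModule) (/ K)) in SL.
      revert SL; apply is_series_ext; intros k; unfold Rpower, scal; simpl; unfold mult; simpl.
      change (match k with O => 1 | S _ => INR k + 1 end) with (INR (S k)).
      rewrite Lh, Rmult_plus_distr_l, exp_plus.
      as_real_eq; unfold K in *; field; split; [lra | generalize (exp_pos (- (1 + u) * ln (2 * PI))); lra].
    + rewrite EL.
      replace (cos (PI / 2 * u)) with (sin (PI * v))
        by (rewrite <- cos_shift; f_equal; unfold v; field).
      (* One factor 2 PI of (2 PI)^(1+u) cancels against the PI of [J]; the factor 2 that remains is
         the 2 of the theorem. *)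
      assert (EK : / K = 2 * (exp (u * ln (2 * PI)) * sin (PI * v))).
      { unfold K, J; replace (- (1 + u) * ln (2 * PI)) with (- (u * ln (2 * PI) + ln (2 * PI))) by ring.
        rewrite exp_Ropp, exp_plus, exp_ln by lra.
        assert (P := exp_pos (u * ln (2 * PI))); field; lra. }
      rewrite EK; ring.
Qed.

(** * Expansion in powers of u *)

(** The norm |x| + |y| is submultiplicative for [cmul], and it controls real and imaginary parts in
    a single induction. *)
Lemma cpow_norm1 (z : cplx) (n : nat) :
  Rabs (fst (cpow z n)) + Rabs (snd (cpow z n)) <= (Rabs (fst z) + Rabs (snd z)) ^ n.
Proof.
  induction n as [| n IH]; simpl; [rewrite Rabs_R1, Rabs_R0; lra |].
  set (p := fst (cpow z n)) in *; set (q := snd (cpow z n)) in *.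
  assert (A := Rabs_triang (fst z * p) (- (snd z * q))).
  assert (B := Rabs_triang (fst z * q) (snd z * p)).
  rewrite Rabs_Ropp in A; rewrite !Rabs_mult in A, B.
  assert (P := Rabs_pos (fst z)); assert (Q := Rabs_pos (snd z)).
  apply Rle_trans with ((Rabs (fst z) + Rabs (snd z)) * (Rabs p + Rabs q)).
  - unfold Rminus; lra.
  - apply Rmult_le_compat_l; lra.
Qed.

(* The real part of [w * exp (u z)], whose [u]-derivative is that of [cmul z w]. *)
Definition re_exp (z w : cplx) (u : R) : R :=
  exp (u * fst z) * (fst w * cos (u * snd z) - snd w * sin (u * snd z)).

Lemma is_derive_re_exp (z w : cplx) (u : R) : is_derive (re_exp z w) u (re_exp z (cmul z w) u).
Proof. unfold re_exp, cmul; simpl; auto_derive; [exact I | ring]. Qed.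

Lemma Derive_n_re_exp (z : cplx) (n : nat) (u : R) :
  Derive_n (re_exp z (1, 0)) n u = re_exp z (cpow z n) u.
Proof.
  revert u; induction n as [| n IH]; intros u; [reflexivity |].
  simpl Derive_n; rewrite (Derive_ext _ _ _ IH).
  apply is_derive_unique, is_derive_re_exp.
Qed.

Lemma ex_derive_n_re_exp (z : cplx) (n : nat) (u : R) : ex_derive_n (re_exp z (1, 0)) n u.
Proof.
  destruct n as [| n]; [exact I |].
  apply (ex_derive_ext (re_exp z (cpow z n))).
  - intros; symmetry; apply Derive_n_re_exp.
  - eexists; apply is_derive_re_exp.
Qed.

Lemma re_exp_bound (z w : cplx) (u v : R) : 0 <= u <= v ->
  Rabs (re_exp z w u) <= exp (v * Rabs (fst z)) * (Rabs (fst w) + Rabs (snd w)).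
Proof.
  intros Huv; unfold re_exp; rewrite Rabs_mult, (Rabs_pos_eq (exp _)) by (left; apply exp_pos).
  apply Rmult_le_compat; [left; apply exp_pos | apply Rabs_pos | |].
  - apply exp_le_compat; assert (P := Rabs_pos (fst z)).
    apply Rle_trans with (u * Rabs (fst z)); [apply Rmult_le_compat_l; [lra | apply Rle_abs] | nra].
  - assert (A := Rabs_triang (fst w * cos (u * snd z)) (- (snd w * sin (u * snd z)))).
    rewrite Rabs_Ropp, !Rabs_mult in A.
    assert (C := COS_bound (u * snd z)); assert (S := SIN_bound (u * snd z)).
    apply Rabs_le_between in C; apply Rabs_le_between in S.
    assert (P := Rabs_pos (fst w)); assert (Q := Rabs_pos (snd w)).
    assert (Rabs (fst w) * Rabs (cos (u * snd z)) <= Rabs (fst w) * 1) by (apply Rmult_le_compat_l; lra).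
    assert (Rabs (snd w) * Rabs (sin (u * snd z)) <= Rabs (snd w) * 1) by (apply Rmult_le_compat_l; lra).
    unfold Rminus; lra.
Qed.

(** Taylor's formula at 0 for a real function of u whose n-th derivative there is the real part of
    z^n. The Lagrange remainder is at most exp(u|Re z|) (uA)^(n+1)/(n+1)!. *)
Lemma re_exp_series (z : cplx) (u : R) : 0 < u ->
  is_series (fun n => u ^ n / INR (fact n) * fst (cpow z n)) (exp (u * fst z) * cos (u * snd z)).
Proof.
  intros Hu; apply is_series_of_lim.
  set (A := Rabs (fst z) + Rabs (snd z)).
  set (K := exp (u * Rabs (fst z))).
  assert (L : is_lim_seq (fun n => (u * A) ^ n / INR (fact n)) 0)
    by apply is_lim_seq_Reals, cv_speed_pow_fact.
  apply is_lim_seq_incr_1 in L; apply (is_lim_seq_scal_l _ K) in L.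
  rewrite Rbar_mult_0_r in L.
  set (g := exp (u * fst z) * cos (u * snd z)).
  assert (B : forall n, Rabs (sum_f_R0 (fun n => u ^ n / INR (fact n) * fst (cpow z n)) n - g)
      <= K * ((u * A) ^ S n / INR (fact (S n)))).
  { intros n.
    destruct (Taylor_Lagrange (re_exp z (1, 0)) n 0 u Hu) as [x [Hx E]].
    { intros; apply ex_derive_n_re_exp. }
    rewrite Rminus_0_r in E.
    replace g with (re_exp z (1, 0) u) by (unfold re_exp, g; simpl; ring).
    rewrite E.
    rewrite (sum_eq (fun m => u ^ m / INR (fact m) * Derive_n (re_exp z (1, 0)) m 0)
              (fun n => u ^ n / INR (fact n) * fst (cpow z n))).
    - set (T := sum_f_R0 _ _).
      match goal with |- Rabs (T - (T + ?r)) <= _ => replace (T - (T + r)) with (- r) by ring end.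
      rewrite Rabs_Ropp, Rabs_mult, Rabs_pos_eq.
      + rewrite Derive_n_re_exp.
        assert (Bx := re_exp_bound z (cpow z (S n)) x u ltac:(lra)); fold K in Bx.
        assert (Bn := cpow_norm1 z (S n)); fold A in Bn.
        rewrite Rpow_mult_distr.
        replace (K * (u ^ S n * A ^ S n / INR (fact (S n)))) with (u ^ S n / INR (fact (S n)) * (K * A ^ S n))
          by (field; apply INR_fact_neq_0).
        apply Rmult_le_compat_l.
        * apply Rdiv_le_0_compat; [apply pow_le; lra | apply INR_fact_lt_0].
        * eapply Rle_trans; [exact Bx |].
          apply Rmult_le_compat_l; [left; apply exp_pos | exact Bn].
      + apply Rdiv_le_0_compat; [apply pow_le; lra | apply INR_fact_lt_0].
    - intros m _; rewrite Derive_n_re_exp; unfold re_exp.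
      rewrite !Rmult_0_l, exp_0, cos_0, sin_0; ring. }
  apply is_lim_seq_le_le with
    (fun n => g - K * ((u * A) ^ S n / INR (fact (S n))))
    (fun n => g + K * ((u * A) ^ S n / INR (fact (S n)))).
  - intros n; specialize (B n); apply Rabs_le_between in B; lra.
  - replace (Finite g) with (Finite (g - 0)) by (f_equal; ring).
    apply is_lim_seq_minus'; [apply is_lim_seq_const | exact L].
  - replace (Finite g) with (Finite (g + 0)) by (f_equal; ring).
    apply is_lim_seq_plus'; [apply is_lim_seq_const | exact L].
Qed.

(** Induction on n: the derivative of the difference is n+1 times the previous difference. It serves
    to absorb the n-th power of the logarithm into an exponential. *)
Lemma pow_le_fact_exp (n : nat) (x : R) : 0 <= x -> x ^ n <= INR (fact n) * exp x.
Proof.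
  intros Hx; assert (0 <= INR (fact n) * exp x - x ^ n); [| lra].
  revert x Hx; induction n as [| n IH]; intros x Hx.
  - simpl; generalize (exp_ineq1_le x); lra.
  - revert x Hx; apply nonneg_of_derive with (fun x => INR (S n) * (INR (fact n) * exp x - x ^ n)).
    + intros x; rewrite fact_simpl, mult_INR; auto_derive; [exact I |].
      change (match n with O => 1 | S _ => INR n + 1 end) with (INR (S n)); simpl pred; ring.
    + intros x Hx; apply Rmult_le_pos; [apply pos_INR | now apply IH].
    + rewrite pow_i, exp_0 by lia; generalize (INR_fact_lt_0 (S n)); lra.
Qed.

Definition log_moment (n : nat) (y : R) : R :=
  mu_log y * Re (cpow (ln (2 * PI) - y, PI / 2) n).

Lemma cpow_continuous (n : nat) (y : R) :
  continuous (fun y => fst (cpow (ln (2 * PI) - y, PI / 2) n)) y /\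
  continuous (fun y => snd (cpow (ln (2 * PI) - y, PI / 2) n)) y.
Proof.
  assert (C : continuous (fun y => ln (2 * PI) - y) y).
  { apply (ex_derive_continuous (V := R_NormedModule)); auto_derive; exact I. }
  induction n as [| n [IH1 IH2]]; simpl; [split; apply continuous_const |].
  split.
  - apply (continuous_minus (V := R_NormedModule)
      (fun y => (ln (2 * PI) - y) * fst (cpow (ln (2 * PI) - y, PI / 2) n))
      (fun y => PI / 2 * snd (cpow (ln (2 * PI) - y, PI / 2) n))).
    + now apply (continuous_mult (K := R_AbsRing) (fun y => ln (2 * PI) - y)).
    + now apply (continuous_scal_r (V := R_NormedModule)).
  - apply (continuous_plus (V := R_NormedModule)
      (fun y => (ln (2 * PI) - y) * snd (cpow (ln (2 * PI) - y, PI / 2) n))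
      (fun y => PI / 2 * fst (cpow (ln (2 * PI) - y, PI / 2) n))).
    + now apply (continuous_mult (K := R_AbsRing) (fun y => ln (2 * PI) - y)).
    + now apply (continuous_scal_r (V := R_NormedModule)).
Qed.

Lemma log_moment_continuous n y : continuous (log_moment n) y.
Proof.
  apply (continuous_mult (K := R_AbsRing) mu_log (fun y => fst (cpow (ln (2 * PI) - y, PI / 2) n))).
  - apply mu_log_continuous.
  - exact (proj1 (cpow_continuous n y)).
Qed.

(** With X bounding |a - y|, the power X^n = 2^n (X/2)^n is at most 2^n n! exp(X/2), which uses up
    half of the decay rate 1 of [mu_log]. That [K] is independent of n is what allows summation over
    n. *)
Lemma log_moment_dominated : exists K, forall n,
  exp_dominated (log_moment n) (K * (2 ^ n * INR (fact n))) (1 / 2).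
Proof.
  set (A := Rabs (ln (2 * PI)) + PI / 2).
  exists (12 * exp (A / 2)); intros n y; unfold log_moment, Re.
  set (z := (ln (2 * PI) - y, PI / 2)).
  assert (HPI := PI_RGT_0).
  assert (B := cpow_norm1 z n); assert (M := mu_log_dominated y).
  assert (P := Rabs_pos (snd (cpow z n))).
  set (X := Rabs (fst z) + Rabs (snd z)) in B.
  assert (HX : 0 <= X <= A + Rabs y).
  { unfold X, z, A; simpl; rewrite (Rabs_pos_eq (PI / 2)) by lra.
    assert (T := Rabs_triang (ln (2 * PI)) (- y)); rewrite Rabs_Ropp in T.
    generalize (Rabs_pos (ln (2 * PI) - y)); unfold Rminus in *; lra. }
  assert (F := pow_le_fact_exp n (X / 2) ltac:(lra)).
  assert (F2 : X ^ n <= 2 ^ n * INR (fact n) * exp (A / 2 + Rabs y / 2)).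
  { replace (X ^ n) with (2 ^ n * (X / 2) ^ n) by (rewrite <- Rpow_mult_distr; f_equal; field).
    rewrite Rmult_assoc; apply Rmult_le_compat_l; [apply pow_le; lra |].
    eapply Rle_trans; [exact F |].
    apply Rmult_le_compat_l; [apply pos_INR | apply exp_le_compat; lra]. }
  rewrite Rabs_mult.
  apply Rle_trans with (12 * exp (- (1) * Rabs y) * (2 ^ n * INR (fact n) * exp (A / 2 + Rabs y / 2))).
  - apply Rmult_le_compat; [apply Rabs_pos | apply Rabs_pos | exact M | lra].
  - replace (- (1 / 2) * Rabs y) with (- (1) * Rabs y + Rabs y / 2) by field.
    rewrite !exp_plus; right; ring.
Qed.

Lemma line_integral_lim (f : R -> R) (l : R) : line_integral f l ->
  is_lim_seq (fun k => RInt f (- INR k) (INR k)) l.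
Proof.
  intros H; apply is_lim_seq_spec; intros eps.
  destruct (H eps (cond_pos eps)) as [M HM].
  destruct (INR_unbounded M) as [N HN]; exists N; intros n Hn.
  assert (X := le_INR _ _ Hn); apply HM; lra.
Qed.

(** A limit along symmetric intervals gives one explicit sequence of values, as needed for the
    coefficients of a power series. *)
Definition log_moment_integral (n : nat) : R :=
  real (Lim_seq (fun k => RInt (log_moment n) (- INR k) (INR k))).

Lemma log_moment_integral_correct (n : nat) : line_integral (log_moment n) (log_moment_integral n).
Proof.
  destruct log_moment_dominated as [K HK].
  destruct (dominated_line_integral (log_moment n) _ _ (log_moment_continuous n) (HK n)) as [l Hl]; [lra |].
  unfold log_moment_integral; now rewrite (is_lim_seq_unique _ _ (line_integral_lim _ _ Hl)).
Qed.

(** The expansion of Re exp(u(a - y)) is integrated term by term against [mu_log]; the factorials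
    cancel and the dominating series is geometric of ratio 2u < 1. *)
Lemma log_moment_generating (u l : R) : 0 < u < 1 / 2 ->
  line_integral (fun y => mu_log y * exp (- u * y)) l ->
  is_series (fun n => u ^ n / INR (fact n) * log_moment_integral n)
    (exp (u * ln (2 * PI)) * cos (PI / 2 * u) * l).
Proof.
  intros Hu Hl.
  set (c := exp (u * ln (2 * PI)) * cos (PI / 2 * u)).
  assert (Cm : forall y, continuous (fun y => mu_log y * exp (- u * y)) y).
  { intros y; apply (continuous_mult (K := R_AbsRing) mu_log); [apply mu_log_continuous |].
    apply (ex_derive_continuous (V := R_NormedModule)); auto_derive; exact I. }
  destruct log_moment_dominated as [K HK].
  assert (G : is_series (fun n => K * (2 * u) ^ n) (K * / (1 - 2 * u))).
  { apply (is_series_scal_l (V := R_NormedModule) K), is_series_geom; rewrite Rabs_pos_eq; lra. }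
  destruct (line_integral_series (fun n y => u ^ n / INR (fact n) * log_moment n y)
    (fun y => c * (mu_log y * exp (- u * y))) (fun n => K * (2 * u) ^ n)
    (fun n => u ^ n / INR (fact n) * log_moment_integral n) (K * / (1 - 2 * u)) (1 / 2)) as [_ [L [HL SL]]].
  - intros n y; apply (continuous_scal_r (V := R_NormedModule)), log_moment_continuous.
  - intros y; apply (continuous_scal_r (V := R_NormedModule)), Cm.
  - lra.
  - intros n y; specialize (HK n y); assert (F := INR_fact_lt_0 n).
    assert (W : 0 <= u ^ n / INR (fact n)) by (apply Rdiv_le_0_compat; [apply pow_le; lra | exact F]).
    rewrite Rabs_mult, (Rabs_pos_eq (_ / _)) by exact W.
    replace (K * (2 * u) ^ n * exp (- (1 / 2) * Rabs y)) with
      (u ^ n / INR (fact n) * (K * (2 ^ n * INR (fact n)) * exp (- (1 / 2) * Rabs y)))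
      by (rewrite Rpow_mult_distr; field; lra).
    now apply Rmult_le_compat_l.
  - exact G.
  - intros y; assert (S := re_exp_series (ln (2 * PI) - y, PI / 2) u ltac:(lra)).
    apply (is_series_scal_l (V := R_NormedModule) (mu_log y)) in S; simpl in S.
    replace (c * (mu_log y * exp (- u * y))) with
      (scal (mu_log y) (exp (u * (ln (2 * PI) - y)) * cos (u * (PI / 2)))).
    + revert S; apply is_series_ext; intros n; unfold log_moment, Re, scal; simpl; unfold mult; simpl.
      as_real_eq; ring.
    + unfold c, scal; simpl; unfold mult; simpl.
      replace (u * (ln (2 * PI) - y)) with (u * ln (2 * PI) + - u * y) by ring.
      rewrite exp_plus, (Rmult_comm u (PI / 2)); ring.
  - intros n; apply line_integral_scal; [apply log_moment_continuous | apply log_moment_integral_correct].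
  - replace (c * l) with L; [exact SL |].
    exact (line_integral_unique _ _ _ HL (line_integral_scal _ c l Cm Hl)).
Qed.

(** * Uniqueness of coefficients from a right interval *)

(** Convergence at r/2 makes the radius positive, so the sum is continuous at 0, where its value d_0
    is the limit of zeros as u decreases to 0. *)
Lemma power_series_const_zero (r : R) (d : nat -> R) : 0 < r ->
  (forall u, 0 < u < r -> is_series (fun k => d k * u ^ k) 0) -> d O = 0.
Proof.
  intros Hr H; apply Rabs_lt_eps_eq; intros e He.
  assert (CV : Rbar_lt (Rabs 0) (CV_radius d)).
  { rewrite Rabs_R0; apply Rbar_lt_le_trans with (Rabs (r / 2)); [simpl; rewrite Rabs_pos_eq; lra |].
    apply Rbar_not_lt_le; intros C; apply (CV_disk_outside _ _ C).
    apply ex_series_lim_0; exists 0; apply H; rewrite ?Rabs_pos_eq; lra. }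
  destruct (PSeries_continuity d 0 CV e He) as [del [Hd K]]; simpl in K.
  set (u := Rmin del r / 2).
  assert (U1 := Rmin_l del r); assert (U2 := Rmin_r del r).
  assert (U3 : 0 < Rmin del r) by (apply Rmin_glb_lt; lra).
  specialize (K u); unfold Rdist in K; rewrite Rminus_0_r, PSeries_0 in K.
  rewrite Rminus_0_r, <- Rabs_Ropp.
  replace (- d O) with (PSeries d u - d O).
  - apply K; split; [split; [exact I | unfold u; lra] | rewrite Rabs_pos_eq; unfold u; lra].
  - unfold PSeries; rewrite (is_series_unique _ 0); [ring | apply H; unfold u; lra].
Qed.

(** Once d_0 = 0 the series can be divided by u > 0, which shifts the coefficients; hence the
    induction quantifies over all sequences [d]. *)
Lemma power_series_zero (r : R) (n : nat) : 0 < r -> forall d : nat -> R,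
  (forall u, 0 < u < r -> is_series (fun k => d k * u ^ k) 0) -> d n = 0.
Proof.
  intros Hr; induction n as [| n IH]; intros d H; [now apply (power_series_const_zero r) |].
  apply (IH (fun k => d (S k))); intros u Hu.
  assert (D0 := power_series_const_zero r d Hr H).
  assert (S1 : is_series (fun k => d (S k) * u ^ S k) 0).
  { apply (is_series_incr_1 (fun k => d k * u ^ k)).
    match goal with |- is_series _ ?m => replace m with (0 : R); [now apply H |] end.
    unfold plus; simpl; rewrite D0; ring. }
  apply (is_series_scal_l (V := R_NormedModule) (/ u)) in S1.
  replace (0 : R) with (scal (/ u) (0 : R)) by apply Rmult_0_r.
  revert S1; apply is_series_ext; intros k; unfold scal; simpl; unfold mult; simpl.
  as_real_eq; field; lra.
Qed.

(** Substitution y = ln t. The thresholds exp(-M) and exp M turn the two independent limits at 0 and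
    infinity into those of the line. *)
Lemma improper_integral_of_line_integral (F g : R -> R) (l : R) :
  (forall y, continuous g y) -> (forall t, 0 < t -> F t = / t * g (ln t)) ->
  line_integral g l -> improper_integral_0_inf F l.
Proof.
  intros Cg E Hl.
  assert (I : forall a b, 0 < a -> 0 < b -> is_RInt F a b (RInt g (ln a) (ln b))).
  { intros a b Ha Hb.
    assert (Hm : 0 < Rmin a b) by now apply Rmin_glb_lt.
    apply (is_RInt_ext (fun t => scal (/ t) (g (ln t)))).
    - intros t Ht; unfold scal; simpl; unfold mult; simpl; symmetry; apply E; lra.
    - apply (is_RInt_comp (V := R_CompleteNormedModule) g ln Rinv).
      + intros; apply Cg.
      + intros t Ht; split; [auto_derive; [lra | field; lra] |].
        apply (ex_derive_continuous (V := R_NormedModule)); auto_derive; lra. }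
  split.
  - intros a b Ha Hab; constructor; apply ex_RInt_Reals_0.
    exists (RInt g (ln a) (ln b)); apply I; lra.
  - intros e He; destruct (Hl e He) as [M HM].
    exists (exp (- M)); split; [apply exp_pos |].
    exists (exp M); split; [apply exp_pos |].
    intros a b pr Ha Had Hb.
    assert (Hb0 : 0 < b) by (generalize (exp_pos M); lra).
    rewrite <- RInt_Reals, (is_RInt_unique (V := R_CompleteNormedModule) _ _ _ _ (I a b Ha Hb0)).
    apply HM.
    + rewrite <- (ln_exp (- M)); now apply ln_increasing.
    + rewrite <- (ln_exp M); apply ln_increasing; [apply exp_pos | exact Hb].
Qed.

Theorem theorem2p2 (mu : nat -> R)
  (Hmu : forall s z, 1 < s -> is_zeta s z ->
           infinite_sum (fun k => mu k * (s - 1) ^ k) (s * (s - 1) * z))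
  (n : nat) :
  exists l,
    improper_integral_0_inf (fun t => mu_fun t * Re (cpow (a_minus_log t) n)) l /\
    mu n = 2 / INR (Factorial.fact n) * l.
Proof.
  exists (log_moment_integral n); split.
  - apply (improper_integral_of_line_integral _ (log_moment n)).
    + apply log_moment_continuous.
    + intros t Ht; unfold log_moment, mu_log, a_minus_log; rewrite exp_ln by exact Ht; field; lra.
    + apply log_moment_integral_correct.
  - apply Rminus_diag_uniq.
    (* On 0 < u < 1/2 both coefficient sequences sum to u (1+u) zeta(1+u), so their difference has
       sum 0 there. *)
    apply (power_series_zero (1 / 2) n ltac:(lra)
      (fun k => mu k - 2 / INR (fact k) * log_moment_integral k)).
    intros u Hu.
    destruct (zeta_mellin u Hu) as [z [l [Hz [Hl E]]]].
    (* The hypothesis on [mu] is applied at s = 1 + u > 1, with the value of zeta supplied by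
       [zeta_mellin]. *)
    assert (S1 := Hmu (1 + u) z ltac:(lra) ltac:(now apply is_series_Reals)).
    replace (1 + u - 1) with u in S1 by ring.
    apply is_series_Reals in S1.
    assert (S2 := log_moment_generating u l Hu Hl).
    apply (is_series_scal_l (V := R_NormedModule) 2) in S2.
    assert (S := is_series_minus (V := R_NormedModule) _ _ _ _ S1 S2).
    match type of S with is_series _ ?x => replace x with (0 : R) in S end.
    + revert S; apply is_series_ext; intros k; unfold minus, plus, opp, scal; simpl; unfold mult; simpl.
      as_real_eq; field; apply INR_fact_neq_0.
    + unfold minus, plus, opp, scal; simpl; unfold mult; simpl; lra.
Qed.
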